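(* Fix $k<0$. For Lebesgue-almost every $c>0$, the following holds almost surely. Let $\widehat r^0\in\mathcal C_{c,k}$, and let $\tau_L,\tau_R,X_L,X_R,Y_L,Y_R$ be defined from $\widehat r^0$ and $X$ as in the context. Let $H_R$ be the second antiderivative of $\widehat r^0$ (i.e. a primitive of a primitive of $\widehat r^0$) such that $H_R(c)=Y_R(c)$ and $H_R(\tau_R)=Y_R(\tau_R)$, and let $H_L$ be the second antiderivative of $\widehat r^0$ such that $H_L(-c)=Y_L(-c)$ and $H_L(\tau_L)=Y_L(\tau_L)$. Then $\widehat r^0=\operatorname{argmin}_{r\in\mathcal C_{c,k}}\phi_c(r)$ if and only if the following three conditions hold: 1. $(H_R-Y_R)(0)=(H_L-Y_L)(0)$; 2. $(H_R-Y_R)(t)\le 0$ for $0\le t\le c$, and $(H_L-Y_L)(t)\le0$ for $-c\le t\le 0$; 3. $\displaystyle\int_{[-c,0]}(H_L-Y_L)\,d(\widehat r^0)'=0=\int_{[0,c]}(H_R-Y_R)\,d(\widehat r^0)'$.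
   Context: $W$ is a standard two-sided Brownian motion started from $0$, and $dX(t)=-12t^2\,dt+dW(t)$, i.e. $X(t)=W(t)-4t^3$. For $c>0$, $$\phi_c(r):=\frac12\int_{-c}^c r(u)^2\,du-\int_{-c}^c r(u)\,dX(u),$$ where the last integral is pathwise (Stieltjes, defined by integration by parts, since $r$ is concave and $X$ is continuous). For $c>0$, $k<0$, $$\mathcal C_{c,k}:=\{r:[-c,c]\to\mathbb R \ :\ r\text{ concave},\ r(0)=0,\ r(c)=r(-c)=k\}.$$ For $\widehat r^0\in\mathcal C_{c,k}$, the knot set $\widehat S^0$ is the complement of $\{t:(\widehat r^0)''(t)=0\}$ (so $t\in\widehat S^0$ iff the second derivative fails to exist at $t$ or is nonzero). Put $$\tau_R:=\inf(\widehat S^0\cap[0,c)),\qquad \tau_L:=\sup(\widehat S^0\cap(-c,0]),$$ which are taken to be well defined and finite. For $t\in[-c,c]$ put $$X_R(t):=\int_{\tau_R}^t dX=X(t)-X(\tau_R),\quad X_L(t):=\int_t^{\tau_L}dX=X(\tau_L)-X(t),$$ $$Y_R(t):=\int_{\tau_R}^tX_R(u)\,du,\quad Y_L(t):=\int_t^{\tau_L}X_L(u)\,du.$$ $(\widehat r^0)'$ is the (one-sided) derivative of the concave function $\widehat r^0$, a nonincreasing function, and $d(\widehat r^0)'$ is the corresponding (nonpositive) Lebesgue–Stieltjes measure.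
   Formalization: The candidate r̂⁰ is additionally assumed continuous on [-c,c] (no jump at ±c); with a jump, d(r̂⁰)' is not defined on the closed interval and the ''if'' direction fails. Competitors in the class C_{c,k} may still jump at ±c. *)

(* Defs.v *)
(* MathComp / MathComp-Analysis *)
From HB Require Import structures.
From mathcomp Require Import all_boot all_order all_algebra.
From mathcomp Require Import all_classical all_reals all_analysis.

Set Implicit Arguments.
Unset Strict Implicit.
Unset Printing Implicit Defensive.

Import Order.TTheory GRing.Theory Num.Theory.
Import numFieldNormedType.Exports.

Local Open Scope classical_set_scope.
Local Open Scope ring_scope.

Definition mutually_independent (d : measure_display) (T : measurableType d)
    (R : realType) (P : probability T R) (n : nat) (X : 'I_n -> T -> R) : Prop :=
  forall B : 'I_n -> set R, (forall i, measurable (B i)) ->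
    P [set w | forall i, B i (X i w)] = (\prod_(i < n) P (X i @^-1` B i))%E.

(* [normal_prob m s] takes the standard deviation [s]. *)
Record two_sided_brownian (d : measure_display) (T : measurableType d)
    (R : realType) (P : probability T R) (W : R -> {RV P >-> R}) : Prop := {
  brownian_start : {ae P, forall w, W 0 w = 0} ;
  brownian_paths : {ae P, forall w, continuous (fun t : R => W t w)} ;
  brownian_gaussian : forall s t : R, s < t ->
    forall B : set R, measurable B ->
      P ((fun w => W t w - W s w) @^-1` B) =
      normal_prob 0 (Num.sqrt (t - s)) B ;
  brownian_indep : forall (n : nat) (t : nat -> R),
    (forall i, (i < n)%N -> t i < t i.+1) ->
    mutually_independent P
      (fun (i : 'I_n) (w : T) => W (t i.+1) w - W (t i) w) }.

Definition drift_path (d : measure_display) (T : measurableType d)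
    (R : realType) (P : probability T R) (W : R -> {RV P >-> R}) (w : T) : R -> R :=
  fun t => W t w - 4 * t ^+ 3.

(* [is_RS_integral f g a b I]: the Riemann-Stieltjes sums of f against g over
   tagged partitions a = x_0 < ... < x_n = b, where s = [:: x_1; ...; x_n],
   converge to I as the mesh tends to 0. *)
Definition is_RS_integral (R : realType) (f g : R -> R) (a b I : R) : Prop :=
  forall e : R, 0 < e -> exists2 h : R, 0 < h &
    forall (s : seq R) (xi : nat -> R), itv_partition a b s ->
      let x := nth b (a :: s) in
      (forall i, (i < size s)%N ->
         [/\ x i <= xi i, xi i <= x i.+1 & x i.+1 - x i < h]) ->
      `| \sum_(0 <= i < size s) f (xi i) * (g (x i.+1) - g (x i)) - I | < e.

Definition RS_integral (R : realType) (f g : R -> R) (a b : R) : R :=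
  get (is_RS_integral f g a b).

(* \int_a^b r dX for r of bounded variation and X continuous (but possibly of
   unbounded variation), defined through integration by parts. *)
Definition parts_integral (R : realType) (r X : R -> R) (a b : R) : R :=
  r b * X b - r a * X a - RS_integral X r a b.

Definition phi (R : realType) (X : R -> R) (c : R) (r : R -> R) : R :=
  2^-1 * (\int[lebesgue_measure]_(u in `[- c, c]) (r u ^+ 2))
  - parts_integral r X (- c) c.

Definition concave_on (R : realType) (D : set R) (r : R -> R) : Prop :=
  @convex_function R R^o D (fun x => - r x).

(* Functions on [-c, c] are represented by functions on R whose values outside
   [-c, c] are irrelevant. A concave function on [-c, c] may jump down at the
   endpoints, so members of the class need not be continuous there. *)
Definition concave_class (R : realType) (c k : R) : set (R -> R) :=
  [set r | [/\ concave_on `[- c, c] r, r 0 = 0, r c = k & r (- c) = k]].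

(* [r0] is the unique minimizer of [F] over [C], functions being identified
   when they agree on [D]. *)
Definition is_argmin (R : realType) (D : set R) (C : set (R -> R))
    (F : (R -> R) -> R) (r0 : R -> R) : Prop :=
  [/\ C r0, (forall r, C r -> F r0 <= F r) &
      forall r, C r -> (forall s, C s -> F r <= F s) -> {in D, r =1 r0}].

Definition second_derivative_zero (R : realType) (r : R -> R) (t : R) : Prop :=
  (\forall x \near t, derivable r x 1) /\ is_derive t 1 (derive1 r) 0.

Definition knots (R : realType) (r : R -> R) : set R :=
  ~` [set t | second_derivative_zero r t].

Definition tauR (R : realType) (c : R) (r : R -> R) : R :=
  inf (knots r `&` `[0, c[).

Definition tauL (R : realType) (c : R) (r : R -> R) : R :=
  sup (knots r `&` `]- c, 0]).

Definition oriented_integral (R : realType) (f : R -> R) (a b : R) : R :=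
  if a <= b then \int[lebesgue_measure]_(u in `[a, b]) f u
  else - \int[lebesgue_measure]_(u in `[b, a]) f u.

Definition XR (R : realType) (X : R -> R) (tau t : R) : R := X t - X tau.

Definition XL (R : realType) (X : R -> R) (tau t : R) : R := X tau - X t.

Definition YR (R : realType) (X : R -> R) (tau t : R) : R :=
  oriented_integral (XR X tau) tau t.

Definition YL (R : realType) (X : R -> R) (tau t : R) : R :=
  oriented_integral (XL X tau) t tau.

Definition is_primitive (R : realType) (f F : R -> R) (a b : R) : Prop :=
  derivable_oo_LRcontinuous F a b /\ {in `]a, b[, derive1 F =1 f}.

Definition is_second_antiderivative (R : realType) (f H : R -> R) (a b : R) :
    Prop :=
  exists2 G : R -> R, is_primitive f G a b & is_primitive G H a b.

Definition right_derivative (R : realType) (r : R -> R) (x : R) : R :=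
  lim ((r (x + h) - r x) / h @[h --> 0^'+]).

(* [mu] is the nonnegative Lebesgue-Stieltjes measure -d(r') of a function r
   concave on [-c, c], r' being its right derivative. It may have infinite mass
   near -c and c, where r' may be unbounded, and is given no atom there. *)
Definition is_minus_dderiv (R : realType) (c : R) (r : R -> R)
    (mu : {measure set (measurableTypeR R) -> \bar R}) : Prop :=
  (forall a b : R, - c < a -> a <= b -> b < c ->
     mu `]a, b]%classic = (right_derivative r a - right_derivative r b)%:E) /\
  mu (~` `]- c, c[%classic) = 0%E.

(* Main.v *)
Require Import Defs.
From HB Require Import structures.
From mathcomp Require Import all_boot all_order all_algebra.
From mathcomp Require Import all_classical all_reals all_analysis.
From mathcomp Require Import measurable_realfun unstable.
From mathcomp Require Import ring lra.

Set Implicit Arguments.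
Unset Strict Implicit.
Unset Printing Implicit Defensive.

Import Order.TTheory GRing.Theory Num.Theory.
Import numFieldNormedType.Exports.

Local Open Scope classical_set_scope.
Local Open Scope ring_scope.

(** The argument is pathwise: X is a fixed continuous path, r0 the candidate,
    and r an arbitrary competitor.

    Reduction to a linear problem.  Let G be a primitive of r0 and let B be a
    primitive of E = G - X - const, with the two free constants chosen so that
    B (- c) = B c = 0; thus B is a second antiderivative of r0 du - dX.
    Integration by parts gives phi r - phi r0 as half the squared L2 distance
    of r and r0, minus the difference of int E dr and int E dr0
    (phi_expansion).  So r0 is a minimizer iff it maximizes the linear
    functional r |-> int E dr over the class.

    Computing int E dr.  On a uniform partition with mesh h, the mean value
    theorem for B provides tags at which the Riemann-Stieltjes sums of int E dr
    become the discrete Dirichlet form, the sum of (Delta B) (Delta r) / h.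
    Abel summation turns it into a sum of B times second differences of r
    (dirichlet_form_abel), whose signs are known since r is concave.  This
    avoids derivatives of r near - c and c, where they may blow up, and
    handles competitors that jump at the endpoints.

    Multipliers.  The constraint r 0 = 0 is dual to the tent T x = 1 - |x| / c:
    the Dirichlet form of T with r only depends on r (- c), r 0 and r c
    (tent_dirichlet_form).  Hence r0 is optimal iff for some lam the function
    Q = B - lam T is nonpositive and vanishes at the bends of r0, the points
    near which the slope of r0 is not constant.  Sufficiency is
    argmin_of_multiplier: the form of Q is nonpositive for every competitor
    and tends to 0 for r0.  Necessity is argmin_bend_le: otherwise one moves
    the curvature of r0 near a bend z to another point t, in the proportion
    that keeps the value at 0, and increases int E dr.

    Translation.  H_R - Y_R and B have the same second derivative, so they
    differ by an affine function; since H_R - Y_R vanishes at c, it equals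
    B - lamR T on [0, c] for some lamR.  Likewise H_L - Y_L equals B - lamL T on
    [- c, 0].  Condition 1 says lamR = lamL, condition 2 that Q is nonpositive,
    and condition 3 that Q vanishes almost everywhere for the measure - d r0',
    which amounts to vanishing at the bends.  Conversely tau_R and tau_L are
    bends, and the normalizations of H_R and H_L there force lamR and lamL to be
    the optimal multiplier. *)

(** * Riemann-Stieltjes sums *)

Section RiemannStieltjes.
Context {R : realType}.
Implicit Types (a b x y xi e h I J : R) (F g X : R -> R).

(** A candidate value that is additive over subintervals, here F y - F x, needs
    only be compared with a single term X xi * (g y - g x): the errors add up to
    at most e times the total increment of g, whatever the partition.  This
    yields existence and value of the integral at once, without refining
    partitions. *)
Lemma is_RS_integral_potential F g X a b : {homo g : x y / x <= y} ->
  (forall e, 0 < e -> exists2 h, 0 < h & forall x xi y,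
     a <= x -> x <= xi -> xi <= y -> y <= b -> y - x < h ->
     `|F y - F x - X xi * (g y - g x)| <= e * (g y - g x)) ->
  is_RS_integral X g a b (F b - F a).
Proof.
move=> gnd Fgap e e0.
have [gab|gab] := leP (g b) (g a).
  have [h h0 Hh] := Fgap _ ltr01; exists h => // s xi abs x Hx.
  have ab := itv_partition_le abs.
  have gE i : (i <= size s)%N -> g (x i) = g a.
    move=> si; apply/eqP; rewrite eq_le; apply/andP; split.
      by rewrite (le_trans _ gab)// gnd//; exact: itv_partition_nth_le.
    by rewrite gnd//; exact: itv_partition_nth_ge.
  have x0 : x 0%N = a by [].
  have xs : x (size s) = b by exact: itv_partition_nth_size.
  have -> : F b - F a = \sum_(0 <= i < size s) (F (x i.+1) - F (x i)).
    by rewrite telescope_sumr// x0 xs.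
  rewrite -sumrB big_nat big1 ?normr0// => i /= si.
  have [xxi xix xh] := Hx i si.
  have := Hh (x i) (xi i) (x i.+1); rewrite !gE//; last exact: ltnW.
  rewrite subrr !mulr0 subr0 => H; apply/eqP; rewrite sub0r oppr_eq0 -normr_le0.
  apply: H => //; last exact: itv_partition_nth_le.
  by apply: itv_partition_nth_ge => //; exact: leqW.
have g0 : 0 < g b - g a by rewrite subr_gt0.
have [h h0 Hh] := Fgap (e / 2 / (g b - g a)) ltac:(by rewrite !divr_gt0).
exists h => // s xi abs x Hx.
have x0 : x 0%N = a by [].
have xs : x (size s) = b by exact: itv_partition_nth_size.
have -> : F b - F a = \sum_(0 <= i < size s) (F (x i.+1) - F (x i)).
  by rewrite telescope_sumr// x0 xs.
rewrite -sumrB; apply: (@le_lt_trans _ _ (e / 2)); last first.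
  by rewrite ltr_pdivrMr// ltr_pMr// ltr1n.
have -> : e / 2 = \sum_(0 <= i < size s)
    (e / 2 / (g b - g a) * (g (x i.+1) - g (x i))).
  by rewrite -mulr_sumr telescope_sumr// x0 xs mulfVK// gt_eqF.
apply: (le_trans (ler_norm_sum _ _ _)).
rewrite big_nat [leRHS]big_nat; apply: ler_sum => i /= si.
rewrite distrC; have [xxi xix xh] := Hx i si; apply: Hh => //.
  by apply: itv_partition_nth_ge => //; exact: leqW.
exact: itv_partition_nth_le.
Qed.

Lemma is_RS_integralD X g1 g2 a b I J :
  is_RS_integral X g1 a b I -> is_RS_integral X g2 a b J ->
  is_RS_integral X (g1 \+ g2) a b (I + J).
Proof.
move=> H1 H2 e e0; have e20 : 0 < e / 2 by rewrite divr_gt0.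
have [h1 h10 {}H1] := H1 _ e20; have [h2 h20 {}H2] := H2 _ e20.
exists (Num.min h1 h2); first by rewrite lt_min h10.
move=> s xi abs x Hx.
have {}H1 := H1 s xi abs; have {}H2 := H2 s xi abs.
rewrite (_ : _ - (I + J) =
  (\sum_(0 <= i < size s) X (xi i) * (g1 (x i.+1) - g1 (x i)) - I) +
  (\sum_(0 <= i < size s) X (xi i) * (g2 (x i.+1) - g2 (x i)) - J)); last first.
  rewrite addrACA -big_split/= -opprD; congr (_ - _).
  by apply: eq_bigr => i _; rewrite -mulrDr opprD addrACA.
rewrite (splitr e) (le_lt_trans (ler_normD _ _))// ltrD//.
  by apply: H1 => i /Hx[? ?]; rewrite lt_min => /andP[].
by apply: H2 => i /Hx[? ?]; rewrite lt_min => /andP[].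
Qed.

Lemma is_RS_integralZ X g k a b I :
  is_RS_integral X g a b I -> is_RS_integral X (fun x => k * g x) a b (k * I).
Proof.
move=> H1 e e0; have e20 : 0 < e / (`|k| + 1).
  by rewrite divr_gt0// ltr_wpDl.
have [h1 h10 {}H1] := H1 _ e20; exists h1 => // s xi abs x Hx.
have {}H1 := H1 s xi abs Hx.
rewrite (_ : _ - k * I = k *
  (\sum_(0 <= i < size s) X (xi i) * (g (x i.+1) - g (x i)) - I)); last first.
  rewrite mulrBr mulr_sumr; congr (_ - _).
  by apply: eq_bigr => i _; rewrite -mulrBr mulrCA.
rewrite normrM (@le_lt_trans _ _ (`|k| * (e / (`|k| + 1))))//.
  by rewrite ler_wpM2l// ltW.
by rewrite mulrA ltr_pdivrMr ?ltr_wpDl// mulrC ltr_pM2l// ltrDl.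
Qed.

Lemma is_RS_integralB X g1 g2 a b I J :
  is_RS_integral X g1 a b I -> is_RS_integral X g2 a b J ->
  is_RS_integral X (g1 \- g2) a b (I - J).
Proof.
move=> H1 /(is_RS_integralZ (-1)); rewrite mulN1r => H2.
have := is_RS_integralD H1 H2; congr is_RS_integral.
by apply/funext => x /=; rewrite mulN1r.
Qed.

Lemma is_RS_integralBl X1 X2 g a b I J :
  is_RS_integral X1 g a b I -> is_RS_integral X2 g a b J ->
  is_RS_integral (X1 \- X2) g a b (I - J).
Proof.
move=> H1 H2 e e0; have e20 : 0 < e / 2 by rewrite divr_gt0.
have [h1 h10 {}H1] := H1 _ e20; have [h2 h20 {}H2] := H2 _ e20.
exists (Num.min h1 h2); first by rewrite lt_min h10.
move=> s xi abs x Hx.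
have {}H1 := H1 s xi abs; have {}H2 := H2 s xi abs.
rewrite (_ : _ - (I - J) =
  (\sum_(0 <= i < size s) X1 (xi i) * (g (x i.+1) - g (x i)) - I) -
  (\sum_(0 <= i < size s) X2 (xi i) * (g (x i.+1) - g (x i)) - J)); last first.
  rewrite (_ : \sum_(0 <= i < size s) (X1 \- X2) (xi i) * _ =
    \sum_(0 <= i < size s) X1 (xi i) * (g (x i.+1) - g (x i)) -
    \sum_(0 <= i < size s) X2 (xi i) * (g (x i.+1) - g (x i))); first by ring.
  by rewrite -sumrB; apply: eq_bigr => i _; rewrite -mulrBl.
rewrite (splitr e) (le_lt_trans (ler_normB _ _))// ltrD//.
  by apply: H1 => i /Hx[? ?]; rewrite lt_min => /andP[].
by apply: H2 => i /Hx[? ?]; rewrite lt_min => /andP[].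
Qed.

Lemma is_RS_integral_cst k g a b : is_RS_integral (cst k) g a b (k * (g b - g a)).
Proof.
move=> e e0; exists 1 => // s xi abs x Hx.
have x0 : x 0%N = a by [].
have xs : x (size s) = b by exact: itv_partition_nth_size.
by rewrite -mulr_sumr telescope_sumr// x0 xs subrr normr0.
Qed.

Lemma eq_is_RS_integral X g1 g2 a b I : {in `[a, b], g1 =1 g2} ->
  is_RS_integral X g1 a b I -> is_RS_integral X g2 a b I.
Proof.
move=> g12 H e /H[h h0 {}H]; exists h => // s xi abs x Hx.
have := H s xi abs Hx.
rewrite big_nat [in X in _ -> X]big_nat.
under eq_bigr => i si.
  have g12x j : (j <= size s)%N -> g1 (x j) = g2 (x j).
    move=> js; apply: g12; rewrite in_itv/=; apply/andP; split.
      exact: itv_partition_nth_ge.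
    exact: itv_partition_nth_le.
  rewrite -/(x _) !g12x//; last exact: ltnW.
  over.
by [].
Qed.

Definition unif_node a b (n i : nat) : R := a + i%:R * ((b - a) / n%:R).

Lemma unif_node0 a b n : unif_node a b n 0 = a.
Proof. by rewrite /unif_node mul0r addr0. Qed.

Lemma unif_nodeS a b n i :
  unif_node a b n i.+1 = unif_node a b n i + (b - a) / n%:R.
Proof. by rewrite /unif_node -natr1 mulrDl mul1r addrA. Qed.

Lemma unif_nodeN a b n : unif_node a b n.+1 n.+1 = b.
Proof. by rewrite /unif_node mulrC mulfVK ?pnatr_eq0// addrC subrK. Qed.

Lemma unif_node_lt a b n i : a < b ->
  unif_node a b n.+1 i < unif_node a b n.+1 i.+1.
Proof. by move=> ab; rewrite unif_nodeS ltrDl divr_gt0// subr_gt0. Qed.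

Lemma unif_node_in a b n i : a < b -> (i <= n.+1)%N ->
  a <= unif_node a b n.+1 i <= b.
Proof.
move=> ab iln; apply/andP; split.
  by rewrite lerDl mulr_ge0// divr_ge0// subr_ge0 ltW.
rewrite -lerBrDl mulrCA ler_piMr ?subr_ge0 ?(ltW ab)//.
by rewrite ler_pdivrMr// mul1r ler_nat.
Qed.

Lemma unif_mesh_cvg0 a b : (fun n => (b - a) / n.+1%:R) @ \oo --> (0 : R).
Proof.
rewrite -[X in _ --> X](mulr0 (b - a)).
by apply: cvgMr; exact: cvg_harmonic.
Qed.

(** The tags are left free so that they can be taken from the mean value
    theorem. *)
Lemma is_RS_integral_unif X g a b I (xi : nat -> nat -> R) : a < b ->
  (forall n i, (i < n.+1)%N ->
     unif_node a b n.+1 i <= xi n i <= unif_node a b n.+1 i.+1) ->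
  is_RS_integral X g a b I ->
  (fun n => \sum_(0 <= i < n.+1) X (xi n i) *
     (g (unif_node a b n.+1 i.+1) - g (unif_node a b n.+1 i))) @ \oo --> I.
Proof.
move=> ab Hxi H; apply/cvgrPdist_lt => e e0.
have [h h0 {}H] := H e e0.
have /cvgrPdist_lt/(_ h h0) := unif_mesh_cvg0 a b.
apply: filterS => n; rewrite sub0r normrN ger0_norm; last first.
  by rewrite divr_ge0// subr_ge0 ltW.
move=> meshh; rewrite distrC.
pose s := [seq unif_node a b n.+1 i.+1 | i <- iota 0 n.+1].
have ss : size s = n.+1 by rewrite size_map size_iota.
have nthE i : (i <= n.+1)%N -> nth b (a :: s) i = unif_node a b n.+1 i.
  case: i => [|i] ilt /=; first by rewrite unif_node0.
  by rewrite (nth_map 0%N) ?size_iota// nth_iota.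
have abs : itv_partition a b s.
  split.
    apply/(pathP b) => i; rewrite ss => iln.
    rewrite nthE; last exact: ltnW.
    by rewrite (nth_map 0%N) ?size_iota// nth_iota// unif_node_lt.
  by apply/eqP; rewrite (last_nth b) ss nthE// unif_nodeN.
have := H s (xi n) abs; cbv zeta; rewrite ss.
have -> : \sum_(0 <= i < n.+1) X (xi n i) *
    (g (nth b (a :: s) i.+1) - g (nth b (a :: s) i)) =
  \sum_(0 <= i < n.+1) X (xi n i) *
     (g (unif_node a b n.+1 i.+1) - g (unif_node a b n.+1 i)).
  rewrite big_nat [RHS]big_nat; apply: eq_bigr => i /= iln.
  by rewrite -!nthE//; exact: ltnW.
apply => i iln; rewrite !nthE//; last exact: ltnW.
have /andP[-> ->] := Hxi n i iln; split => //.
by rewrite unif_nodeS addrAC subrr add0r.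
Qed.

Lemma is_RS_integral_unique X g a b I J : a < b ->
  is_RS_integral X g a b I -> is_RS_integral X g a b J -> I = J.
Proof.
move=> ab HI HJ.
have Hxi n i : (i < n.+1)%N -> unif_node a b n.+1 i <= unif_node a b n.+1 i
    <= unif_node a b n.+1 i.+1 by rewrite lexx/= ltW ?unif_node_lt.
have cI := is_RS_integral_unif ab Hxi HI.
have cJ := is_RS_integral_unif ab Hxi HJ.
exact: (cvg_unique _ cI cJ).
Qed.

Lemma RS_integralE X g a b I : a < b ->
  is_RS_integral X g a b I -> RS_integral X g a b = I.
Proof.
move=> ab HI; apply: (@is_RS_integral_unique X g a b) => //.
by apply: (@getPex _ (is_RS_integral X g a b)); exists I.
Qed.

End RiemannStieltjes.

(** * Existence of Riemann-Stieltjes integrals *)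

Section UniformContinuity.
Context {R : realType}.

Lemma segment_unif_continuous (X : R -> R) (a b e : R) : continuous X -> 0 < e ->
  exists2 h, 0 < h & forall x y, a <= x <= b -> `|x - y| < h ->
    `|X x - X y| < e.
Proof.
move=> cX e0.
have /compact_near_coveringP := @segment_compact R a b.
move=> /(_ R (0^'+) (fun h x => forall y, `|x - y| < h -> `|X x - X y| < e)).
move=> /(_ _) cov.
have /cov H : forall x, `[a, b]%classic x -> \forall x' \near x & h \near 0^'+,
    forall y, `|x' - y| < h -> `|X x' - X y| < e.
  move=> x xab.
  have e20 : 0 < e / 2 by rewrite divr_gt0.
  have /cvgrPdist_lt/(_ _ e20)/nbhs_ballP[d/= d0 Hd] := cX x.
  exists (ball x (d / 2), [set h | h < d / 2]) => /=.
    split; first by apply: nbhsx_ballx; rewrite divr_gt0.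
    by apply: nbhs_right_lt; rewrite divr_gt0.
  move=> [x' h] /= [xx' hd] y x'y.
  have Hx' : `|X x - X x'| < e / 2.
    by apply: Hd; apply: (lt_trans xx'); rewrite ltr_pdivrMr// ltr_pMr// ltr1n.
  have Hy : `|X x - X y| < e / 2.
    apply: Hd; rewrite /ball/= (splitr d) -(subrK x' x) -addrA.
    by rewrite (le_lt_trans (ler_normD _ _))// ltrD// (lt_trans x'y).
  rewrite (splitr e) -(subrK (X x) (X x')) -addrA.
  by rewrite (le_lt_trans (ler_normD _ _))// ltrD// distrC.
have /filter_ex[h [h0 Hh]] : \forall h \near 0^'+, (0 : R) < h /\
      `[a, b]%classic `<=` (fun x => forall y, `|x - y| < h -> `|X x - X y| < e).
    near=> h; split; first by near: h; exact: nbhs_right_gt.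
    by near: h; exact: H.
exists h => // x y xab; apply: Hh.
by rewrite /= in_itv.
Unshelve. all: by end_near. Qed.

End UniformContinuity.

Section MonotoneIntegrator.
Context {R : realType}.
Notation leb := (@lebesgue_measure R).
Implicit Types (a b x y v e : R) (X g : R -> R).

(** The generalized inverse of a nondecreasing g on [a, b].  The point a belongs
    to the set for every v, so that the supremum is taken over a nonempty
    set. *)
Definition gen_inverse g a b v : R := sup [set x | a <= x <= b /\ (x = a \/ g x <= v)].

Lemma gen_inverse_has_sup g a b v : a <= b ->
  has_sup [set x | a <= x <= b /\ (x = a \/ g x <= v)].
Proof.
move=> ab; split; first by exists a; split; [rewrite lexx|left].
by exists b => x /= [/andP[]].
Qed.

Lemma gen_inverse_nondecreasing g a b : a <= b ->
  {homo gen_inverse g a b : v w / v <= w}.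
Proof.
move=> ab v w vw; apply: ge_sup; first by have [] := gen_inverse_has_sup g v ab.
move=> x /= [xab Hx]; apply: ub_le_sup.
  by have [] := gen_inverse_has_sup g w ab.
by split => //; case: Hx => [|/le_trans/(_ vw)]; [left|right].
Qed.

Lemma gen_inverse_ge g a b x v : a <= b -> a <= x <= b -> g x <= v ->
  x <= gen_inverse g a b v.
Proof.
move=> ab xab gxv; apply: ub_le_sup; first by have [] := gen_inverse_has_sup g v ab.
by split => //; right.
Qed.

Lemma gen_inverse_le g a b y v : {homo g : x y / x <= y} -> a <= y <= b ->
  v < g y -> gen_inverse g a b v <= y.
Proof.
move=> gnd /andP[ay yb] vgy.
apply: ge_sup; first by have [] := gen_inverse_has_sup g v (le_trans ay yb).
move=> x /= [xab [->//|gxv]].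
by rewrite leNgt; apply/negP => /ltW/gnd; rewrite leNgt (le_lt_trans gxv).
Qed.

Lemma gen_inverse_in g a b v : a <= b -> a <= gen_inverse g a b v <= b.
Proof.
move=> ab; have hs := gen_inverse_has_sup g v ab; apply/andP; split.
  by apply: ub_le_sup; [case: hs|split; [rewrite lexx|left]].
by apply: ge_sup; [case: hs|move=> x /= [/andP[]]].
Qed.

(** Change of variable v = g x: the integral is the Lebesgue integral of
    X o g^-1 over [g a, g b].  Between g x and g y the generalized inverse stays
    in [x, y], so uniform continuity of X gives the local estimate; jumps of g
    become intervals on which the inverse is constant and need no separate
    treatment. *)
Lemma is_RS_integral_monotone X g a b : a <= b -> continuous X ->
  {homo g : x y / x <= y} -> exists I, is_RS_integral X g a b I.
Proof.
move=> ab cX gnd.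
pose m v := X (gen_inverse g a b v).
have mm D : measurable D -> measurable_fun D m.
  move=> mD; apply: (@measurableT_comp _ _ _ _ _ _ X).
    exact: continuous_measurable_fun.
  by apply: nondecreasing_measurable => //; exact: gen_inverse_nondecreasing.
have [M HM] : exists M, forall v, `|m v| <= M.
  have cX' : {within `[a, b], continuous (Num.Def.normr \o X)}.
    apply: continuous_subspaceT => x; apply: continuous_comp; first exact: cX.
    exact: norm_continuous.
  have [c _ Hc] := EVT_max ab cX'.
  by exists `|X c| => v; apply: Hc; rewrite in_itv/= gen_inverse_in.
have im x y : leb.-integrable `[x, y] (EFin \o m).
  apply: measurable_bounded_integrable => //; last 2 first.
  - exact: mm.
  - exists M; split; first exact: num_real.
    by move=> N MN v _ /=; rewrite (le_trans (HM v))// ltW.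
  rewrite /= lebesgue_measure_itv/=; case: ifPn => // _.
  by rewrite -EFinB ltry.
pose F x := \int[leb]_(v in `[g a, g x]) m v.
exists (F b - F a); apply: is_RS_integral_potential => // e e0.
have [h h0 Hh] := segment_unif_continuous a b cX e0.
exists h => // x xi y ax xxi xiy yb yxh.
have xy := le_trans xxi xiy.
have -> : F y - F x = \int[leb]_(v in `]g x, g y]) m v.
  by rewrite /F Rintegral_itvB// ?bnd_simp ?gnd.
rewrite Rintegral_itv_obnd_cbnd; last first.
  by apply: integrableS (im (g x) (g y)) => //; exact: subset_itv_oc_cc.
have ico : leb.-integrable `[g x, g y[ (EFin \o m).
  by apply: integrableS (im (g x) (g y)) => //; exact: subset_itv_co_cc.
have icst k : leb.-integrable `[g x, g y[ (EFin \o cst k).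
  have ik : leb.-integrable `[g x, g y] (EFin \o cst k).
    apply: continuous_compact_integrable; first exact: segment_compact.
    by apply: continuous_subspaceT => ?; exact: cvg_cst.
  by apply: integrableS ik => //; exact: subset_itv_co_cc.
have muco : fine (leb `[g x, g y[) = g y - g x.
  rewrite lebesgue_measure_itv/= lte_fin; case: ltP => [//|].
  by move=> yx /=; apply/eqP; rewrite eq_sym subr_eq0 eq_le yx gnd.
rewrite -Rintegral_itv_bndo_bndc//.
have -> : X xi * (g y - g x) = \int[leb]_(v in `[g x, g y[) (cst (X xi) v).
  by rewrite Rintegral_cst//= muco.
rewrite -RintegralB//.
have iB : leb.-integrable `[g x, g y[ (EFin \o (fun v => m v - cst (X xi) v)).
  by have := integrableB _ ico (icst (X xi)); apply.
apply: (le_trans (le_normr_Rintegral _ iB)) => //.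
have -> : e * (g y - g x) = \int[leb]_(v in `[g x, g y[) (cst e v).
  by rewrite Rintegral_cst//= muco.
apply: le_Rintegral => //.
- by have := integrable_norm iB.
- move=> v /=; rewrite in_itv/= => /andP[gxv vgy].
  have xm : x <= gen_inverse g a b v.
    by apply: gen_inverse_ge => //; rewrite ax (le_trans xy).
  have my : gen_inverse g a b v <= y.
    by apply: gen_inverse_le => //; rewrite yb (le_trans ax).
  apply/ltW/Hh; first exact: gen_inverse_in.
  by rewrite (le_lt_trans _ yxh)// ler_distlC; apply/andP; split; lra.
Qed.

End MonotoneIntegrator.

(** * Primitives and integration by parts *)

Section IntegralsOfContinuousFunctions.
Context {R : realType}.
Notation leb := (@lebesgue_measure R).
Implicit Types (a b x y c e : R) (f g G rho : R -> R).

Lemma continuous_integrable f a b : continuous f ->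
  leb.-integrable `[a, b] (EFin \o f).
Proof.
move=> cf; apply: continuous_compact_integrable; first exact: segment_compact.
exact: continuous_subspaceT.
Qed.

Lemma Rintegral_chasles f a b c : a <= b -> b <= c ->
  leb.-integrable `[a, c] (EFin \o f) ->
  \int[leb]_(u in `[a, c]) f u =
  \int[leb]_(u in `[a, b]) f u + \int[leb]_(u in `[b, c]) f u.
Proof.
move=> ab bc fi; rewrite -(@Rintegral_itv_obnd_cbnd _ b); last first.
  by apply: integrableS fi => // x /=; rewrite !in_itv/= => /andP[/ltW bx ->];
    rewrite (le_trans ab).
by rewrite -(Rintegral_itvB fi) ?bnd_simp// addrC subrK.
Qed.

(** Moving the base point below both bounds removes the case distinction on
    orientation. *)
Lemma oriented_integralE f a y c : continuous f -> c <= a -> c <= y ->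
  oriented_integral f a y =
  \int[leb]_(u in `[c, y]) f u - \int[leb]_(u in `[c, a]) f u.
Proof.
move=> cf ca cy; rewrite /oriented_integral; case: leP => [ay|/ltW ya].
  rewrite (Rintegral_chasles ca ay (continuous_integrable _ _ cf)).
  by rewrite addrAC subrr add0r.
rewrite (Rintegral_chasles cy ya (continuous_integrable _ _ cf)).
by rewrite opprD addrA subrr add0r.
Qed.

Lemma is_derive_oriented_integral f a x : continuous f ->
  is_derive x 1 (oriented_integral f a) (f x).
Proof.
move=> cf; pose c := Num.min a x - 1.
have ca : c <= a by rewrite /c lerBlDr ge_min lerDl ler01.
have cx : c < x by rewrite /c ltrBlDr gt_min ltrDl ltr01 orbT.
have xx1 : x < x + 1 by rewrite ltrDl.
have [dF F'] := continuous_FTC1_closed xx1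
  (continuous_integrable c (x + 1) cf) cx (cf x).
have : is_derive x 1 (fun y => \int[leb]_(u in `[c, y]) f u -
    \int[leb]_(u in `[c, a]) f u) (f x - 0).
  apply: is_deriveB.
  by apply: DeriveDef; [exact: dF|rewrite -F' derive1E].
rewrite subr0; apply: near_eq_is_derive.
near=> y; rewrite (@oriented_integralE f a y c)//.
by apply: ltW; near: y; exact: lt_nbhsr.
Unshelve. all: by end_near. Qed.

Lemma oriented_integralN f a b : oriented_integral f a b = - oriented_integral f b a.
Proof.
rewrite /oriented_integral; case: (ltgtP a b) => [ab|ba|->].
- by rewrite opprK.
- by [].
- by rewrite set_itv1 Rintegral_set1 oppr0.
Qed.

Lemma is_derive_continuous G rho : (forall x : R, is_derive x 1 G (rho x)) ->
  continuous G.
Proof.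
move=> dG x; apply: differentiable_continuous.
by apply/derivable1_diffP; have [] := dG x.
Qed.

Lemma Rintegral_derivative G rho x y : continuous rho ->
  (forall x : R, is_derive x 1 G (rho x)) -> x <= y ->
  \int[leb]_(u in `[x, y]) rho u = G y - G x.
Proof.
move=> crho dG; rewrite le_eqVlt => /predU1P[<-|xy].
  by rewrite set_itv1 Rintegral_set1 subrr.
have cG := is_derive_continuous dG.
rewrite /Rintegral (@continuous_FTC2 _ rho G)//.
- exact: continuous_subspaceT.
- split; first by move=> z _; have [] := dG z.
  + exact/cvg_at_right_filter/cG.
  + exact/cvg_at_left_filter/cG.
- by move=> z _; rewrite derive1E; have [] := dG z.
Qed.

Lemma monotone_continuous_integrable g rho a b : continuous rho ->
  {homo g : x y / x <= y} -> leb.-integrable `[a, b] (EFin \o (rho \* g)).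
Proof.
move=> crho gnd.
have [ba|ab] := ltP b a.
  by rewrite set_itv_ge ?bnd_simp -?ltNge//; exact: integrable_set0.
have [M0 [_ HM0]] : bounded_set (rho @` `[a, b]).
  apply: compact_bounded; apply: continuous_compact; last exact: segment_compact.
  exact: continuous_subspaceT.
have HM x : a <= x <= b -> `|rho x| <= M0 + 1.
  by move=> xab; apply: HM0; [rewrite ltrDl|exists x => //=; rewrite in_itv].
apply: measurable_bounded_integrable => //.
- by rewrite /= lebesgue_measure_itv/=; case: ifPn => // _; rewrite -EFinB ltry.
- apply: measurable_funM; last exact: nondecreasing_measurable.
  by apply: measurable_funTS; exact: continuous_measurable_fun.
- exists ((M0 + 1) * (`|g a| + `|g b|)); split; first exact: num_real.
  move=> N MN x /=; rewrite in_itv/= => xab; have /andP[/gnd ga /gnd gb] := xab.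
  apply: (le_trans _ (ltW MN)); rewrite normrM ler_pM ?HM// ler_norml.
  have := ler_norm (g b); have := ler_norm (- g a); rewrite normrN.
  by have := normr_ge0 (g b); have := normr_ge0 (g a); lra.
Qed.

(** The antiderivative of the Stieltjes integral is G g - int rho g: on a short
    interval its increment differs from G xi * (g y - g x) by two terms, each
    bounded by sup |rho| times the mesh times the increment of g. *)
Lemma is_RS_integral_by_parts G rho g a b : a <= b -> continuous rho ->
  (forall x : R, is_derive x 1 G (rho x)) -> {homo g : x y / x <= y} ->
  is_RS_integral G g a b
    (G b * g b - G a * g a - \int[leb]_(u in `[a, b]) (rho u * g u)).
Proof.
move=> ab crho dG gnd.
pose F x := G x * g x - \int[leb]_(u in `[a, x]) (rho u * g u).
have -> : G b * g b - G a * g a - \int[leb]_(u in `[a, b]) (rho u * g u) =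
    F b - F a.
  by rewrite /F set_itv1 Rintegral_set1; ring.
have [M0 [_ HM0]] : bounded_set (rho @` `[a, b]).
  apply: compact_bounded; apply: continuous_compact; last exact: segment_compact.
  exact: continuous_subspaceT.
pose M := `|M0| + 1; have M_gt0 : 0 < M by rewrite ltr_wpDl.
have HM x : a <= x <= b -> `|rho x| <= M.
  move=> xab; apply: HM0; last by exists x => //=; rewrite in_itv.
  by rewrite (le_lt_trans (ler_norm _))// ltrDl.
apply: is_RS_integral_potential => // e e0.
exists (e / (2 * M)); first by rewrite divr_gt0// mulr_gt0.
move=> x xi y ax xxi xiy yb yxh; have xy := le_trans xxi xiy.
have {}yxh : M * (y - x) * 2 <= e.
  by move: yxh; rewrite ltr_pdivlMr ?mulr_gt0// => /ltW; lra.
have irg p q := monotone_continuous_integrable p q crho gnd.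
have irho p q := continuous_integrable p q crho.
have irgx : leb.-integrable `[x, y] (EFin \o (fun u => rho u * g x)).
  by apply: continuous_integrable => u; apply: cvgMl; exact: crho.
have -> : F y - F x - G xi * (g y - g x) =
    (\int[leb]_(u in `[xi, y]) rho u) * (g y - g x) -
    \int[leb]_(u in `[x, y]) (rho u * g u - rho u * g x).
  rewrite (RintegralB _ (irg x y) irgx)// (RintegralZr _ _ (irho x y))//.
  rewrite !(Rintegral_derivative crho dG)//.
  rewrite /F (@Rintegral_chasles (fun u => rho u * g u) a x y)//.
  by ring.
have gxy : 0 <= g y - g x by rewrite subr_ge0 gnd.
have int_le p q : a <= p -> p <= q -> q <= b -> forall f k, 0 <= k ->
    leb.-integrable `[p, q] (EFin \o f) ->
    (forall u, p <= u <= q -> `|f u| <= k) ->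
    `|\int[leb]_(u in `[p, q]) f u| <= k * (q - p).
  move=> ap pq qb f k k0 fi fk; apply: (le_trans (le_normr_Rintegral _ fi)) => //.
  have -> : k * (q - p) = \int[leb]_(u in `[p, q]) cst k u.
    rewrite Rintegral_cst//= lebesgue_measure_itv/= lte_fin; case: ltP => // qp.
    have -> : q = p by apply/eqP; rewrite eq_le qp pq.
    by rewrite subrr.
  apply: le_Rintegral => //.
  - by have := integrable_norm fi.
  - by apply: continuous_integrable => ?; exact: cvg_cst.
have -> : e * (g y - g x) = (e / 2) * (g y - g x) + (e / 2) * (g y - g x).
  by rewrite -mulrDl -splitr.
rewrite (le_trans (ler_normB _ _))// lerD//.
  rewrite normrM (ger0_norm gxy) ler_wpM2r//.
  apply: (@le_trans _ _ (M * (y - xi))).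
    apply: int_le => //; [exact: le_trans xxi|exact: ltW|].
    move=> u /andP[xiu uy]; apply: HM.
    by rewrite (le_trans uy)// (le_trans _ xiu)// (le_trans ax).
  have : M * (y - xi) <= M * (y - x) by rewrite ler_pM2l//; lra.
  by lra.
apply: (@le_trans _ _ (M * (g y - g x) * (y - x))).
  apply: int_le => //; first by rewrite mulr_ge0// ltW.
    by have := integrableB _ (irg x y) irgx; apply.
  move=> u /andP[xu uy]; rewrite -mulrBr normrM ler_pM//.
    by apply: HM; rewrite (le_trans uy)// (le_trans ax).
  by rewrite ger0_norm ?subr_ge0 ?gnd// lerD2r gnd.
rewrite mulrAC ler_wpM2r//; lra.
Qed.

End IntegralsOfContinuousFunctions.

(** * Concave functions and their tangents *)

Section ConcaveFunctions.
Context {R : realType}.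
Implicit Types (lo hi a b p x y z t s : R) (r w : R -> R).

Lemma concave_onP lo hi r : concave_on `[lo, hi] r <->
  forall x y t, lo <= x <= hi -> lo <= y <= hi -> 0 <= t <= 1 ->
    t * r x + (1 - t) * r y <= r (t * x + (1 - t) * y).
Proof.
split => [rc x y t xI yI /andP[t0 t1]|rc t x y].
  have xs : x \in (`[lo, hi]%classic : set R) by rewrite inE/= in_itv.
  have ys : y \in (`[lo, hi]%classic : set R) by rewrite inE/= in_itv.
  have := rc (Itv01 t0 t1) _ _ xs ys.
  by rewrite !convRE/= /onem !mulrN -opprD lerN2.
rewrite !inE/= !in_itv/= => xI yI.
rewrite !convRE/= /onem !mulrN -opprD lerN2; apply: rc => //.
by apply/andP; split.
Qed.

Lemma concave_three_slopes lo hi r x y z : concave_on `[lo, hi] r ->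
  lo <= x -> x <= y -> y <= z -> z <= hi ->
  (r z - r y) * (y - x) <= (r y - r x) * (z - y).
Proof.
move=> /concave_onP rc lox xy yz zhi.
have [zx|xz] := leP z x.
  have -> : x = y by apply/eqP; rewrite eq_le xy (le_trans yz).
  have -> : y = z by apply/eqP; rewrite eq_le yz (le_trans zx).
  by rewrite !subrr.
have xz0 : 0 < z - x by rewrite subr_gt0.
have xI : lo <= x <= hi by lra.
have zI : lo <= z <= hi by lra.
have tI : 0 <= (z - y) / (z - x) <= 1.
  by rewrite divr_ge0 ?ler_pdivrMr ?mul1r ?lerD2l ?lerN2 ?subr_ge0 ?(ltW xz).
have := rc x z _ xI zI tI.
have -> : (z - y) / (z - x) * x + (1 - (z - y) / (z - x)) * z = y.
  by field; rewrite subr_eq0 gt_eqF.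
have -> : (z - y) / (z - x) * r x + (1 - (z - y) / (z - x)) * r z =
   ((z - y) * r x + (y - x) * r z) / (z - x) by field; rewrite subr_eq0 gt_eqF.
rewrite ler_pdivrMr//; lra.
Qed.

Lemma concave_onD lo hi r w : concave_on `[lo, hi] r -> concave_on `[lo, hi] w ->
  concave_on `[lo, hi] (r \+ w).
Proof.
move=> /concave_onP rc /concave_onP wc; apply/concave_onP => x y t xI yI tI /=.
by have := rc x y t xI yI tI; have := wc x y t xI yI tI; lra.
Qed.

Lemma concave_on_affine lo hi a b : concave_on `[lo, hi] (fun x => a + b * x).
Proof. by apply/concave_onP => x y t _ _ _; lra. Qed.

Lemma eq_concave_on lo hi r w : {in `[lo, hi], r =1 w} ->
  concave_on `[lo, hi] r -> concave_on `[lo, hi] w.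
Proof.
move=> rw /concave_onP rc; apply/concave_onP => x y t xI yI tI.
rewrite -!rw; first exact: rc.
all: rewrite in_itv//=; move: xI yI tI => /andP[? ?] /andP[? ?] /andP[? ?].
by apply/andP; split; nra.
Qed.

Lemma concave_conv lo hi r w e : 0 <= e <= 1 ->
  concave_on `[lo, hi] r -> concave_on `[lo, hi] w ->
  concave_on `[lo, hi] (fun x => (1 - e) * r x + e * w x).
Proof.
move=> /andP[e0 e1] /concave_onP rc /concave_onP wc; apply/concave_onP => x y t xI yI tI /=.
have := rc x y t xI yI tI; have := wc x y t xI yI tI.
set W := w (_ + _); set V := r (_ + _) => HW HV.
have : e * (t * w x + (1 - t) * w y) <= e * W by rewrite ler_wpM2l.
have : (1 - e) * (t * r x + (1 - t) * r y) <= (1 - e) * V.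
  by rewrite ler_wpM2l// subr_ge0.
by lra.
Qed.

(** Flattening a concave function after a point up to which it increases keeps
    it concave, as a nondecreasing concave function of the concave x |-> min x p. *)
Lemma concave_on_min lo hi p w : lo <= p ->
  concave_on `[lo, hi] w ->
  (forall x y, lo <= x -> x <= y -> y <= p -> w x <= w y) ->
  concave_on `[lo, hi] (fun x => w (Num.min x p)).
Proof.
move=> lop /concave_onP wc wnd; apply/concave_onP => x y t xI yI tI.
have H u : lo <= u <= hi -> lo <= Num.min u p <= hi.
  by move=> /andP[lou uhi]; rewrite le_min lou lop/= ge_min uhi.
apply: (le_trans (wc _ _ t (H _ xI) (H _ yI) tI)).
have /andP[mx _] := H _ xI; have /andP[my _] := H _ yI.
move: tI => /andP[t0 t1].
have mxx : Num.min x p <= x by rewrite ge_min lexx.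
have myy : Num.min y p <= y by rewrite ge_min lexx.
have mxp : Num.min x p <= p by rewrite ge_min lexx orbT.
have myp : Num.min y p <= p by rewrite ge_min lexx orbT.
apply: wnd; first by nra.
  by rewrite le_min; apply/andP; split; nra.
by rewrite ge_min lexx orbT.
Qed.

Lemma concave_on_max lo hi p w : p <= hi ->
  concave_on `[lo, hi] w ->
  (forall x y, p <= x -> x <= y -> y <= hi -> w y <= w x) ->
  concave_on `[lo, hi] (fun x => w (Num.max x p)).
Proof.
move=> phi /concave_onP wc wnd; apply/concave_onP => x y t xI yI tI.
have H u : lo <= u <= hi -> lo <= Num.max u p <= hi.
  by move=> /andP[lou uhi]; rewrite ge_max uhi phi/= andbT le_max lou.
apply: (le_trans (wc _ _ t (H _ xI) (H _ yI) tI)).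
have /andP[_ mx] := H _ xI; have /andP[_ my] := H _ yI.
move: tI => /andP[t0 t1].
have mxx : x <= Num.max x p by rewrite le_max lexx.
have myy : y <= Num.max y p by rewrite le_max lexx.
have mxp : p <= Num.max x p by rewrite le_max lexx orbT.
have myp : p <= Num.max y p by rewrite le_max lexx orbT.
apply: wnd; last by nra.
  by rewrite le_max lexx orbT.
by rewrite ge_max; apply/andP; split; nra.
Qed.

(** The slopes between x and the points to its right increase to the right
    derivative as these points approach x, and stay below the slopes to the
    left of x. *)
Lemma concave_tangent lo hi r x y : concave_on `[lo, hi] r ->
  lo < x < hi -> lo <= y <= hi ->
  r y <= r x + right_derivative r x * (y - x).
Proof.
move=> rc /andP[lox xhi] /andP[loy yhi].
pose f h := (r (x + h) - r x) / h.
have hx0 : 0 < hi - x by rewrite subr_gt0.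
have fni : {in `]0, (hi - x)[ &, nonincreasing_fun f}.
  move=> h k; rewrite !in_itv/= => /andP[h0 hh] /andP[k0 kh] hk.
  rewrite /f ler_pdivrMr// mulrAC ler_pdivlMr//.
  have := @concave_three_slopes lo hi r x (x + h) (x + k) rc.
  move=> H.
  have : (r (x + k) - r (x + h)) * (x + h - x) <= (r (x + h) - r x) * (x + k - (x + h)).
    by apply: H; lra.
  by lra.
have fub z h : lo <= z -> z < x -> h \in `]0, (hi - x)[ -> f h <= (r x - r z) / (x - z).
  rewrite in_itv/= => loz zx /andP[h0 hh].
  rewrite /f ler_pdivrMr// mulrAC ler_pdivlMr ?subr_gt0//.
  have := @concave_three_slopes lo hi r z x (x + h) rc loz.
  move=> H.
  have : (r (x + h) - r x) * (x - z) <= (r x - r z) * (x + h - x).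
    by apply: H; lra.
  by lra.
have ubf : has_ubound (f @` `]0, (hi - x)[).
  by exists ((r x - r lo) / (x - lo)) => _ [h hh <-]; exact: fub.
have -> : right_derivative r x = sup (f @` `]0, (hi - x)[).
  apply/cvg_lim => //.
  by apply: (@nonincreasing_at_right_cvgr _ _ _ (BLeft (hi - x))); rewrite ?bnd_simp.
have [xy|yx|->] := ltgtP x y; last by rewrite subrr mulr0 addr0.
- rewrite -lerBlDl -ler_pdivrMr ?subr_gt0//.
  pose h := (y - x) / 2.
  have h0 : 0 < h by rewrite divr_gt0// subr_gt0.
  have hI : h \in `]0, (hi - x)[ by rewrite in_itv/= h0/=; rewrite /h; lra.
  apply: (@le_trans _ _ (f h)); last by apply: ub_le_sup => //; exists h.
  rewrite /f ler_pdivrMr ?subr_gt0// mulrAC ler_pdivlMr//.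
  have := @concave_three_slopes lo hi r x (x + h) y rc.
  move=> H.
  have : (r y - r (x + h)) * (x + h - x) <= (r (x + h) - r x) * (y - (x + h)).
    by apply: H; rewrite /h; lra.
  by lra.
- suff : sup (f @` `]0, (hi - x)[) <= (r x - r y) / (x - y).
    by rewrite ler_pdivlMr ?subr_gt0//; lra.
  apply: ge_sup; last by move=> _ [h hh <-]; exact: fub.
  exists (f ((hi - x) / 2)), ((hi - x) / 2) => //=.
  by rewrite in_itv/=; apply/andP; split; lra.
Qed.

Lemma right_derivative_nonincreasing lo hi r x y : concave_on `[lo, hi] r ->
  lo < x -> x <= y -> y < hi -> right_derivative r y <= right_derivative r x.
Proof.
move=> rc lox; rewrite le_eqVlt => /predU1P[->//|xy yhi].
have xI : lo < x < hi by rewrite lox (lt_trans xy).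
have yI : lo < y < hi by rewrite yhi (lt_trans lox).
have tx : r y <= r x + right_derivative r x * (y - x).
  by apply: concave_tangent rc _ _ => //; lra.
have ty : r x <= r y + right_derivative r y * (x - y).
  by apply: concave_tangent rc _ _ => //; lra.
have xy0 : 0 < y - x by rewrite subr_gt0.
by rewrite -(ler_pM2r xy0); lra.
Qed.

Lemma concave_sub_tangent_nd lo hi r p x y : concave_on `[lo, hi] r ->
  lo < p < hi -> lo <= x -> x <= y -> y <= p ->
  r x - right_derivative r p * x <= r y - right_derivative r p * y.
Proof.
move=> rc /andP[lop phi] lox; rewrite le_eqVlt => /predU1P[->//|xy yp].
have yI : lo < y < hi by rewrite (le_lt_trans lox)//= (le_lt_trans yp).
have ty : r x <= r y + right_derivative r y * (x - y).
  by apply: concave_tangent rc _ _ => //; lra.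
have : right_derivative r p <= right_derivative r y.
  by apply: right_derivative_nonincreasing rc _ _ _ => //; lra.
have xy0 : 0 < y - x by rewrite subr_gt0.
by nra.
Qed.

Lemma concave_sub_tangent_ni lo hi r p x y : concave_on `[lo, hi] r ->
  lo < p < hi -> p <= x -> x <= y -> y <= hi ->
  r y - right_derivative r p * y <= r x - right_derivative r p * x.
Proof.
move=> rc /andP[lop phi] px; rewrite le_eqVlt => /predU1P[->//|xy yhi].
have xI : lo < x < hi by rewrite (lt_le_trans lop)//= (lt_le_trans xy).
have tx : r y <= r x + right_derivative r x * (y - x).
  by apply: concave_tangent rc _ _ => //; lra.
have : right_derivative r x <= right_derivative r p.
  by apply: right_derivative_nonincreasing rc _ _ _ => //; lra.
have xy0 : 0 < y - x by rewrite subr_gt0.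
by nra.
Qed.

Lemma concave_on_sub_affine lo hi r s : concave_on `[lo, hi] r ->
  concave_on `[lo, hi] (fun x => r x - s * x).
Proof.
move=> rc; have := concave_onD rc (@concave_on_affine lo hi 0 (- s)).
by apply: eq_concave_on => x _ /=; rewrite add0r mulNr.
Qed.

(** Splitting off the curvature in [a, b]: rho is r on [a, b] continued by its
    tangents at a and b.  Both rho and r - rho are concave, so rho may be
    replaced by any other concave function without leaving the concave class. *)
Lemma concave_localize lo hi r a b : concave_on `[lo, hi] r ->
  lo < a -> a < b -> b < hi ->
  exists rho, [/\ concave_on `[lo, hi] rho,
    concave_on `[lo, hi] (fun x => r x - rho x),
    forall x, lo <= x <= a -> rho x = r a + right_derivative r a * (x - a) &
    forall x, b <= x <= hi -> rho x = r b + right_derivative r b * (x - b)].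
Proof.
move=> rc loa ab bhi.
have aI : lo < a < hi by rewrite loa (lt_trans ab).
have bI : lo < b < hi by rewrite bhi (lt_trans loa).
pose sa := right_derivative r a; pose sb := right_derivative r b.
have sba : sb <= sa by apply: right_derivative_nonincreasing rc _ _ _ => //; lra.
pose wa x := r x - sa * x; pose wb x := r x - sb * x.
pose u x := wa (Num.min x a); pose v x := wb (Num.max x b).
have uc : concave_on `[lo, hi] u.
  apply: concave_on_min; [exact: ltW|exact: concave_on_sub_affine|].
  by move=> x y; exact: concave_sub_tangent_nd.
have vc : concave_on `[lo, hi] v.
  apply: concave_on_max; [exact: ltW|exact: concave_on_sub_affine|].
  by move=> x y; exact: concave_sub_tangent_ni.
pose r1 x := wa (Num.max x a) + sa * x.
have r1c : concave_on `[lo, hi] r1.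
  have : concave_on `[lo, hi] (fun x => wa (Num.max x a)).
    apply: concave_on_max; [lra|exact: concave_on_sub_affine|].
    by move=> x y; exact: concave_sub_tangent_ni.
  move=> /concave_onD/(_ (@concave_on_affine lo hi 0 sa)).
  by apply: eq_concave_on => x _ /=; rewrite add0r.
have r1l x : x <= a -> r1 x = r a + sa * (x - a).
  by move=> xa; rewrite /r1 max_r// /wa; ring.
have r1r x : a <= x -> r1 x = r x.
  by move=> xa; rewrite /r1 max_l// /wa; ring.
pose rho x := (r1 (Num.min x b) - sb * Num.min x b) + sb * x.
have rhoc : concave_on `[lo, hi] rho.
  have : concave_on `[lo, hi] (fun x => r1 (Num.min x b) - sb * Num.min x b).
    apply: (@concave_on_min _ _ _ (fun x => r1 x - sb * x)); first lra.
      exact: concave_on_sub_affine.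
    move=> x y lox xy yb.
    have [ax|/ltW xa] := leP a x.
      rewrite !r1r//; last exact: le_trans xy.
      exact: concave_sub_tangent_nd rc bI lox xy yb.
    have [ay|/ltW ya] := leP a y.
      rewrite (r1r y)// (r1l x)//.
      have := @concave_sub_tangent_nd lo hi r b a y rc bI (ltW loa) ay yb.
      by rewrite -/sb; nra.
    by rewrite !r1l//; nra.
  move=> /concave_onD/(_ (@concave_on_affine lo hi 0 sb)).
  by apply: eq_concave_on => x _ /=; rewrite add0r.
exists rho; split => //.
- have := concave_onD (concave_onD uc vc) (@concave_on_affine lo hi (- wa a - wb b) 0).
  apply: eq_concave_on => x _ /=; rewrite mul0r addr0 /rho /u /v.
  have [xb|/ltW bx] := leP x b.
    have [ax|/ltW xa] := leP a x.
      by rewrite r1r//; ring.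
    by rewrite r1l// /wa /wb; ring.
  have ax : a <= x by apply: le_trans bx; exact: ltW.
  rewrite min_r// r1r ?(ltW ab)// /wa /wb; ring.
- move=> x /andP[_ xa]; rewrite /rho min_l; last by rewrite (le_trans xa)// ltW.
  by rewrite r1l// -/sa; ring.
- move=> x /andP[bx _]; rewrite /rho min_r// r1r ?(ltW ab)// -/sb; ring.
Qed.

End ConcaveFunctions.

(** * Bends and knots *)

Section KnotsAreBends.
Context {R : realType}.
Implicit Types (lo hi x y z d p q : R) (r : R -> R).

(** For concave r the bends in ]lo, hi[ form the support of the measure - d r'. *)
Definition is_bend lo hi r z := forall d, 0 < d -> exists x y,
  [/\ z - d < x, x < y, y < z + d, lo < x /\ y < hi &
   right_derivative r y < right_derivative r x].

Lemma not_bend lo hi r z : ~ is_bend lo hi r z -> exists2 d, 0 < d &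
  forall x y, z - d < x -> x < y -> y < z + d -> lo < x -> y < hi ->
    right_derivative r x <= right_derivative r y.
Proof.
move=> /existsNP[d /not_implyP[d0 H]]; exists d => // x y zx xy yz lox yhi.
by rewrite leNgt; apply/negP => yx; apply: H; exists x, y.
Qed.

(** Where the slope is locally constant the function is locally affine, so its
    second derivative exists and vanishes. *)
Lemma knot_is_bend lo hi r z : concave_on `[lo, hi] r -> lo < z < hi ->
  knots r z -> is_bend lo hi r z.
Proof.
move=> rconc /andP[loz zhi] kz; apply: contrapT => /not_bend[d d0 Hd].
apply: kz; pose s := right_derivative r z.
pose p := Num.max lo (z - d); pose q := Num.min hi (z + d).
have pz : p < z by rewrite gt_max loz ltrBlDr ltrDl.
have zq : z < q by rewrite lt_min zhi ltrDl.
have lop : lo <= p by rewrite le_max lexx.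
have qhi : q <= hi by rewrite ge_min lexx.
have pd : z - d <= p by rewrite le_max lexx orbT.
have qd : q <= z + d by rewrite ge_min lexx orbT.
have rE x : p < x < q -> r x = r z + s * (x - z).
  move=> /andP[px xq].
  have xI : lo < x < hi by rewrite (le_lt_trans lop)//= (lt_le_trans xq).
  have zI : lo < z < hi by rewrite loz.
  have [xz|zx|->] := ltgtP x z; last by rewrite subrr mulr0 addr0.
  - have sl : right_derivative r x <= right_derivative r z by apply: Hd; lra.
    have t1 := @concave_tangent _ lo hi r x z rconc xI ltac:(lra).
    have t2 := @concave_tangent _ lo hi r z x rconc zI ltac:(lra).
    apply/eqP; rewrite eq_le; apply/andP; split => //.
    by rewrite -/s in sl; nra.
  - have sl : right_derivative r z <= right_derivative r x by apply: Hd; lra.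
    have t1 := @concave_tangent _ lo hi r x z rconc xI ltac:(lra).
    have t2 := @concave_tangent _ lo hi r z x rconc zI ltac:(lra).
    apply/eqP; rewrite eq_le; apply/andP; split => //.
    by rewrite -/s in sl; nra.
have dr x : p < x < q -> is_derive x 1 r s.
  move=> /andP[px xq].
  apply: (@near_eq_is_derive _ _ _ (fun y => r z + s * (y - z))).
    near=> y; apply/esym/rE; apply/andP; split; near: y.
      exact: lt_nbhsr.
    exact: lt_nbhsl.
  have d1 : is_derive x 1 (fun y : R => y - z) (1 - 0) by apply: is_deriveB.
  have d2 := @is_deriveZ _ _ _ _ s x 1 _ d1.
  have d3 := @is_deriveD _ _ _ (cst (r z)) _ x 1 0 _ (is_derive_cst _ _ _) d2.
  by apply: is_derive_eq d3 _; rewrite add0r subr0 [_ *: _]mulr1.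
have near_pq : \forall x \near z, p < x < q.
  near=> x; apply/andP; split; near: x; [exact: lt_nbhsr|exact: lt_nbhsl].
split.
  by apply: filterS near_pq => x /dr[].
apply: (@near_eq_is_derive _ _ _ (cst s)).
by apply: filterS near_pq => x /dr[_ <-]; rewrite derive1E.
Unshelve. all: by end_near. Qed.

Lemma tauR_in c r : 0 < c -> knots r `&` `[0, c[ !=set0 -> 0 <= tauR c r < c.
Proof.
move=> c0 [z zS]; have lb : lbound (knots r `&` `[0, c[) 0.
  by move=> x [_ /=]; rewrite in_itv/= => /andP[].
apply/andP; split; first by apply: lb_le_inf; [exists z|].
apply: (@le_lt_trans _ _ z); first by apply: ge_inf => //; exists 0.
by case: zS => _ /=; rewrite in_itv/= => /andP[].
Qed.

Lemma tauL_in c r : 0 < c -> knots r `&` `]- c, 0] !=set0 -> - c < tauL c r <= 0.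
Proof.
move=> c0 [z zS]; have ub : ubound (knots r `&` `]- c, 0]) 0.
  by move=> x [_ /=]; rewrite in_itv/= => /andP[].
apply/andP; split; last by apply: ge_sup; [exists z|].
apply: (@lt_le_trans _ _ z); last by apply: ub_le_sup => //; exists 0.
by case: zS => _ /=; rewrite in_itv/= => /andP[].
Qed.

Lemma is_bend_closed lo hi r z :
  (forall d, 0 < d -> exists2 x, `|x - z| < d & is_bend lo hi r x) ->
  is_bend lo hi r z.
Proof.
move=> H d d0; have d20 : 0 < d / 2 by rewrite divr_gt0.
have [t] := H _ d20; rewrite ltr_norml => /andP[tz1 tz2] /(_ _ d20).
move=> [x [y [tx xy yt I sxy]]]; exists x, y; split => //; lra.
Qed.

Lemma tauR_is_bend c r : 0 < c -> concave_on `[- c, c] r ->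
  knots r `&` `[0, c[ !=set0 -> is_bend (- c) c r (tauR c r).
Proof.
move=> c0 rconc kn; apply: is_bend_closed => d d0.
have hi : has_inf (knots r `&` `[0, c[).
  by split => //; exists 0 => x [_ /=]; rewrite in_itv/= => /andP[].
have [x xS xd] := inf_adherent d0 hi.
have xge : tauR c r <= x by apply: ge_inf => //; case: hi.
exists x; first by rewrite ger0_norm ?subr_ge0// ltrBlDl.
case: xS => kx /=; rewrite in_itv/= => /andP[x0 xc].
by apply: knot_is_bend => //; lra.
Qed.

Lemma tauL_is_bend c r : 0 < c -> concave_on `[- c, c] r ->
  knots r `&` `]- c, 0] !=set0 -> is_bend (- c) c r (tauL c r).
Proof.
move=> c0 rconc kn; apply: is_bend_closed => d d0.
have hs : has_sup (knots r `&` `]- c, 0]).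
  by split => //; exists 0 => x [_ /=]; rewrite in_itv/= => /andP[].
have [x xS xd] := sup_adherent d0 hs.
have xle : x <= tauL c r by apply: ub_le_sup => //; case: hs.
exists x; first by rewrite distrC ger0_norm ?subr_ge0// ltrBlDl -ltrBlDr.
case: xS => kx /=; rewrite in_itv/= => /andP[cx x0].
by apply: knot_is_bend => //; lra.
Qed.

End KnotsAreBends.

(** * Concave integrators and the expansion of the criterion *)

Section ConcaveIntegrator.
Context {R : realType}.
Notation leb := (@lebesgue_measure R).
Implicit Types (c k x y : R) (r s g f X G rho : R -> R).

(** Subtracting the tangent at 0 leaves a function that increases up to 0 and
    decreases afterwards.  Extending the pieces by constants gives functions that
    are monotone on the whole line, whatever r does outside [- c, c]. *)
Lemma concave_monotone_difference c r : 0 < c -> concave_on `[- c, c] r ->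
  exists g1 g2, [/\ {homo g1 : x y / x <= y}, {homo g2 : x y / x <= y} &
    {in `[- c, c], g1 \- g2 =1 r}].
Proof.
move=> c0 rc; pose sl := right_derivative r 0.
have cI : - c < 0 < c by rewrite oppr_lt0 c0.
pose w x := r x - sl * x.
pose w1 x := w (Num.min (Num.max x (- c)) 0).
pose w2 x := w (Num.max (Num.min x c) 0).
have w1nd x y : x <= y -> w1 x <= w1 y.
  move=> xy; apply: (concave_sub_tangent_nd rc cI).
  - by rewrite le_min le_max lexx orbT/= ltW//; case/andP: cI.
  - by rewrite le_min2// le_max2.
  - by rewrite ge_min lexx orbT.
have w2ni x y : x <= y -> w2 y <= w2 x.
  move=> xy; apply: (concave_sub_tangent_ni rc cI).
  - by rewrite le_max lexx orbT.
  - by rewrite le_max2// le_min2.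
  - by rewrite ge_max ge_min lexx orbT/= ltW.
exists (fun x => w1 x - w 0 + Num.max sl 0 * x).
exists (fun x => - w2 x + Num.max (- sl) 0 * x); split.
- move=> x y xy; rewrite lerD//; first by rewrite lerD2r w1nd.
  by rewrite ler_wpM2l// le_max lexx orbT.
- move=> x y xy; rewrite lerD//; first by rewrite lerN2 w2ni.
  by rewrite ler_wpM2l// le_max lexx orbT.
- move=> x; rewrite in_itv/= => /andP[cx xc].
  rewrite /w1 /w2 (max_l cx) (min_l xc).
  have -> : r x = w x + sl * x by rewrite /w subrK.
  have [sl0|/ltW sl0] := leP 0 sl.
    rewrite (@max_r _ _ (- sl) 0) ?oppr_le0//.
    by case: (leP x 0) => _; ring.
  rewrite (@max_l _ _ (- sl) 0) ?oppr_ge0//.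
  by case: (leP x 0) => _; ring.
Qed.

Lemma concave_is_RS_integral X c r : 0 < c -> continuous X ->
  concave_on `[- c, c] r -> exists I, is_RS_integral X r (- c) c I.
Proof.
move=> c0 cX /(concave_monotone_difference c0)[g1 [g2 [g1nd g2nd rE]]].
have cc : - c <= c by lra.
have [I HI] := is_RS_integral_monotone cc cX g1nd.
have [J HJ] := is_RS_integral_monotone cc cX g2nd.
by exists (I - J); apply: eq_is_RS_integral rE _; exact: is_RS_integralB.
Qed.

Lemma concave_by_parts G rho c r : 0 < c -> continuous rho ->
  (forall x : R, is_derive x 1 G (rho x)) -> concave_on `[- c, c] r ->
  is_RS_integral G r (- c) c
    (G c * r c - G (- c) * r (- c) - \int[leb]_(u in `[- c, c]) (rho u * r u)).
Proof.
move=> c0 crho dG /(concave_monotone_difference c0)[g1 [g2 [g1nd g2nd rE]]].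
have cc : - c <= c by lra.
have := is_RS_integralB (is_RS_integral_by_parts cc crho dG g1nd)
  (is_RS_integral_by_parts cc crho dG g2nd).
move/(eq_is_RS_integral rE); congr is_RS_integral.
have -> : \int[leb]_(u in `[- c, c]) (rho u * r u) =
    \int[leb]_(u in `[- c, c]) (rho u * g1 u - rho u * g2 u).
  apply: eq_Rintegral => x; rewrite inE/= => xI.
  by rewrite -rE// mulrBr.
rewrite RintegralB//; try exact: monotone_continuous_integrable.
rewrite -!rE ?in_itv/= ?lexx ?cc//; ring.
Qed.

Lemma concave_measurable_bounded c r : 0 < c -> concave_on `[- c, c] r ->
  measurable_fun `[- c, c] r /\ exists M, forall x, - c <= x <= c -> `|r x| <= M.
Proof.
move=> c0 /(concave_monotone_difference c0)[g1 [g2 [g1nd g2nd rE]]]; split.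
  apply: (eq_measurable_fun (g1 \- g2)) => [x|]; first by rewrite inE/=; exact: rE.
  by apply: measurable_funB; exact: nondecreasing_measurable.
exists (`|g1 (- c)| + `|g1 c| + `|g2 (- c)| + `|g2 c|) => x xI.
rewrite -rE ?in_itv//=; move: xI => /andP[cx xc].
have := g1nd _ _ cx; have := g1nd _ _ xc; have := g2nd _ _ cx; have := g2nd _ _ xc.
have N (t : R) : t <= `|t| /\ - t <= `|t|.
  by split; [exact: ler_norm|rewrite -normrN ler_norm].
have [? ?] := N (g1 (- c)); have [? ?] := N (g1 c).
have [? ?] := N (g2 (- c)); have [? ?] := N (g2 c).
by rewrite ler_norml => ? ? ? ?; apply/andP; split; lra.
Qed.

Lemma concave_mul_integrable c r s : 0 < c ->
  concave_on `[- c, c] r -> concave_on `[- c, c] s ->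
  leb.-integrable `[- c, c] (EFin \o (r \* s)).
Proof.
move=> c0 /(concave_measurable_bounded c0)[mr [M HM]].
move=> /(concave_measurable_bounded c0)[ms [N HN]].
apply: measurable_bounded_integrable => //.
- by rewrite /= lebesgue_measure_itv/=; case: ifPn => // _; rewrite -EFinB ltry.
- exact: measurable_funM.
- exists (M * N); split; first exact: num_real.
  move=> z MNz x /=; rewrite in_itv/= => xI.
  by apply: (le_trans _ (ltW MNz)); rewrite normrM ler_pM ?HM ?HN.
Qed.

Lemma concave_sqrB_integrable c r s : 0 < c ->
  concave_on `[- c, c] r -> concave_on `[- c, c] s ->
  leb.-integrable `[- c, c] (EFin \o (fun u => (r u - s u) ^+ 2)).
Proof.
move=> c0 rc sc.
have i1 := concave_mul_integrable c0 rc rc.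
have i2 : leb.-integrable `[- c, c] (EFin \o (fun u => 2 * (r u * s u))).
  by have := integrableZl _ 2 (concave_mul_integrable c0 rc sc); apply.
have i3 := concave_mul_integrable c0 sc sc.
have i12 : leb.-integrable `[- c, c] (EFin \o (fun u => r u * r u - 2 * (r u * s u))).
  by have := integrableB _ i1 i2; apply.
have : leb.-integrable `[- c, c] (EFin \o
    (fun u => (r u * r u - 2 * (r u * s u)) + s u * s u)).
  by have := integrableD _ i12 i3; apply.
by apply: eq_integrable => // u _ /=; congr EFin; ring.
Qed.

(** The term int r0 (r - r0) of the expanded square is integrated by parts with
    a primitive G of r0 and combines with int (r - r0) dX into one Stieltjes
    integral of G - X; boundary terms cancel as all members of the class
    share their endpoint values. *)
Lemma phi_expansion X G rho c k r0 r : 0 < c -> continuous X -> continuous rho ->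
  (forall x : R, is_derive x 1 G (rho x)) -> {in `[- c, c], rho =1 r0} ->
  concave_class c k r0 -> concave_class c k r ->
  phi X c r - phi X c r0 =
    2^-1 * \int[leb]_(u in `[- c, c]) ((r u - r0 u) ^+ 2)
    - (RS_integral (G \- X) r (- c) c - RS_integral (G \- X) r0 (- c) c).
Proof.
move=> c0 cX crho dG rhoE C0 C.
have [r0c _ r0k r0k'] := C0; have [rc _ rk rk'] := C.
have cc : - c < c by lra.
have E s : concave_on `[- c, c] s -> s c = k -> s (- c) = k ->
    RS_integral (G \- X) s (- c) c =
    G c * k - G (- c) * k - \int[leb]_(u in `[- c, c]) (rho u * s u)
    - RS_integral X s (- c) c.
  move=> sc sk sk'; have [I HI] := concave_is_RS_integral c0 cX sc.
  rewrite (RS_integralE cc HI).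
  have := concave_by_parts c0 crho dG sc; rewrite sk sk' => HG.
  by rewrite (RS_integralE cc (is_RS_integralBl HG HI)).
rewrite (E r)// (E r0)// /phi /parts_integral rk rk' r0k r0k'.
have rhoI s : \int[leb]_(u in `[- c, c]) (rho u * s u) =
    \int[leb]_(u in `[- c, c]) (r0 u * s u).
  by apply: eq_Rintegral => x; rewrite inE/= => xI; rewrite rhoE.
rewrite !rhoI.
have i1 := concave_mul_integrable c0 rc rc.
have i2 := concave_mul_integrable c0 r0c rc.
have i3 := concave_mul_integrable c0 r0c r0c.
have -> : \int[leb]_(u in `[- c, c]) ((r u - r0 u) ^+ 2) =
    \int[leb]_(u in `[- c, c]) (r u * r u)
    - 2 * \int[leb]_(u in `[- c, c]) (r0 u * r u)
    + \int[leb]_(u in `[- c, c]) (r0 u * r0 u).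
  have i2' : leb.-integrable `[- c, c] (EFin \o (fun u => 2 * (r0 u * r u))).
    by have := integrableZl _ 2 i2; apply.
  rewrite -RintegralZl// -RintegralB// -RintegralD//; last first.
    by have := integrableB _ i1 i2'; apply.
  by apply: eq_Rintegral => x _; ring.
under eq_Rintegral do rewrite expr2.
under [X in _ - (_ * X - _)]eq_Rintegral do rewrite expr2.
lra.
Qed.

End ConcaveIntegrator.

(** * The discrete Dirichlet form *)

Lemma cvg_odd_nat : (fun n => n.*2.+1) @ \oo --> \oo.
Proof.
apply/cvgnyPge => A; near=> n.
have An : (A <= n)%N by near: n; exact: nbhs_infty_ge.
by rewrite (leq_trans An)// -addnn ltnW// ltnS leq_addr.
Unshelve. all: by end_near. Qed.

Section DirichletForm.
Context {R : realType}.
Variable c : R.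
Hypothesis c0 : 0 < c.
Implicit Types (a b x y e : R) (f g p r B E Q : R -> R).

Let node m i : R := unif_node (- c) c m.+1 i.
Let mesh m : R := (c - - c) / m.+1%:R.

(** The value of int f' g' for the piecewise linear interpolations of f and g
    on the uniform partition of [- c, c] into m + 1 intervals. *)
Definition dirichlet_form m f g : R := \sum_(0 <= i < m.+1)
  (f (node m i.+1) - f (node m i)) * (g (node m i.+1) - g (node m i)) / mesh m.

(** The sign makes it nonnegative for concave g: this is the discrete
    - g'' at the node of index i + 1, multiplied by the mesh. *)
Definition second_difference m g i : R :=
  ((g (node m i.+1) - g (node m i)) -
   (g (node m i.+2) - g (node m i.+1))) / mesh m.

Let mesh_gt0 m : 0 < mesh m.
Proof. by rewrite divr_gt0// opprK addr_gt0. Qed.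

Let cc : - c < c. Proof. by rewrite -subr_gt0 opprK addr_gt0. Qed.

Let nodeS m i : node m i.+1 = node m i + mesh m.
Proof. exact: unif_nodeS. Qed.

Let node0 m : node m 0 = - c. Proof. exact: unif_node0. Qed.

Let nodeN m : node m m.+1 = c. Proof. exact: unif_nodeN. Qed.

Let node_le m i : node m i <= node m i.+1.
Proof. by rewrite nodeS lerDl ltW. Qed.

Let node_in m i : (i <= m.+1)%N -> - c <= node m i <= c.
Proof. exact: unif_node_in. Qed.

Let mesh_near e : 0 < e -> \forall m \near \oo, mesh m < e.
Proof.
move=> e0; have /cvgrPdist_lt/(_ e e0) := unif_mesh_cvg0 (- c) c.
by apply: filterS => m; rewrite sub0r normrN gtr0_norm// mesh_gt0.
Qed.

Lemma abel_sum (u d : nat -> R) m :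
  \sum_(0 <= i < m.+1) (u i.+1 - u i) * d i =
  u m.+1 * d m - u 0%N * d 0%N + \sum_(0 <= i < m) u i.+1 * (d i - d i.+1).
Proof.
elim: m => [|m IH]; first by rewrite big_nat1 big_geq//; ring.
by rewrite big_nat_recr//= IH [in RHS]big_nat_recr//=; ring.
Qed.

Lemma dirichlet_form_abel m f g : f (- c) = 0 -> f c = 0 ->
  dirichlet_form m f g =
  \sum_(0 <= i < m) f (node m i.+1) * second_difference m g i.
Proof.
move=> fNc fc; rewrite /dirichlet_form.
under eq_bigr do rewrite -mulrA.
rewrite (abel_sum (fun i => f (node m i))
  (fun i => (g (node m i.+1) - g (node m i)) / mesh m)).
rewrite nodeN node0 fc fNc !mul0r subr0 add0r.
by apply: eq_bigr => i _; rewrite -mulrBl.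
Qed.

Lemma sum_second_difference m n g :
  \sum_(0 <= i < n) second_difference m g i =
  ((g (node m 1) - g (node m 0)) - (g (node m n.+1) - g (node m n))) / mesh m.
Proof.
elim: n => [|n IH]; first by rewrite big_geq// subrr mul0r.
by rewrite big_nat_recr//= IH /second_difference -mulrDl; congr (_ / _); ring.
Qed.

Lemma second_difference_ge0 m g i : concave_on `[- c, c] g -> (i < m)%N ->
  0 <= second_difference m g i.
Proof.
move=> gc im; rewrite divr_ge0 ?(ltW (mesh_gt0 m))// subr_ge0.
have /andP[ai _] := @node_in m i (leqW (ltnW im)).
have /andP[_ bi] := @node_in m i.+2 im.
have := @concave_three_slopes _ _ _ _ (node m i) (node m i.+1) (node m i.+2) gc ai
  (node_le _ _) (node_le _ _) bi.
have -> : node m i.+2 - node m i.+1 = mesh m by rewrite nodeS addrAC subrr add0r.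
have -> : node m i.+1 - node m i = mesh m by rewrite nodeS addrAC subrr add0r.
by rewrite ler_pM2r.
Qed.

(** With tags from the mean value theorem for B the Stieltjes sums of E against
    r are exactly the Dirichlet forms. *)
Lemma dirichlet_form_cvg B E r I : (forall x : R, is_derive x 1 B (E x)) ->
  is_RS_integral E r (- c) c I -> dirichlet_form m B r @[m --> \oo] --> I.
Proof.
move=> dB HI.
pose P m i := [set z | node m i <= z <= node m i.+1 /\
  B (node m i.+1) - B (node m i) = E z * mesh m].
have HP m i : P m i (get (P m i)).
  apply: getPex.
  have cB := is_derive_continuous dB.
  have [z zI Bz] := MVT_segment (node_le m i) (fun x _ => dB x) (continuous_subspaceT cB).
  exists z; split; first by move: zI; rewrite in_itv.
  by rewrite Bz nodeS [_ + mesh m]addrC addrK.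
have := @is_RS_integral_unif _ _ _ _ _ _ (fun m i => get (P m i)) cc _ HI.
move=> /(_ _)H.
have {H} := H (fun m i _ => (HP m i).1).
apply: cvg_trans; apply: near_eq_cvg; apply: nearW => m.
apply: eq_bigr => i _; have [_ ->] := HP m i.
by rewrite mulrAC mulfK ?gt_eqF.
Qed.

Lemma dirichlet_form_nonpos m Q r : Q (- c) = 0 -> Q c = 0 ->
  (forall x, - c <= x <= c -> Q x <= 0) -> concave_on `[- c, c] r ->
  dirichlet_form m Q r <= 0.
Proof.
move=> QNc Qc Q0 rc; rewrite dirichlet_form_abel// big_nat sumr_le0// => i /= im.
rewrite mulr_le0_ge0 ?second_difference_ge0// Q0// node_in//.
exact: leqW.
Qed.

(** The second differences of p vanish away from [a, b], and they sum to the
    total drop of slope s1 - s2, so only a lower bound of Q near [a, b]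
    matters. *)
Lemma dirichlet_form_ge a b s1 s2 e d Q p : Q (- c) = 0 -> Q c = 0 ->
  concave_on `[- c, c] p -> - c < a -> b < c ->
  (forall x, - c <= x <= a -> p x = p a + s1 * (x - a)) ->
  (forall x, b <= x <= c -> p x = p b + s2 * (x - b)) ->
  0 < d -> (forall x, - c <= x <= c -> a - d < x < b + d -> e <= Q x) ->
  \forall m \near \oo, e * (s1 - s2) <= dirichlet_form m Q p.
Proof.
move=> QNc Qc pc ca bc pa pb d0 Qd; near=> m.
have md : mesh m < d by near: m; apply: mesh_near.
have ma : mesh m < a + c by near: m; apply: mesh_near; lra.
have mb : mesh m < c - b by near: m; apply: mesh_near; lra.
have m0 := mesh_gt0 m.
rewrite dirichlet_form_abel//.
have <- : \sum_(0 <= i < m) second_difference m p i = s1 - s2.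
  rewrite sum_second_difference.
  have n0 := node0 m; have nm := nodeN m.
  have nm' : node m m = c - mesh m by rewrite -nm nodeS addrK.
  rewrite nm nm' nodeS n0.
  rewrite (pa (- c + _)) ?(pa (- c)) ?(pb c) ?(pb (c - _)); try lra.
  by field; rewrite gt_eqF.
rewrite mulr_sumr big_nat [leRHS]big_nat; apply: ler_sum => i /= im.
have w0 := second_difference_ge0 pc im.
have /andP[i1 i1'] := @node_in m i (leqW (ltnW im)).
have /andP[i2 i2'] := @node_in m i.+2 im.
have n1 : node m i = node m i.+1 - mesh m by rewrite nodeS addrK.
have n2 : node m i.+2 = node m i.+1 + mesh m by rewrite nodeS.
have [xa|xa] := leP (node m i.+1) (a - mesh m).
  have -> : second_difference m p i = 0; last by rewrite !mulr0.
  rewrite /second_difference (pa (node m i)); last by lra.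
  rewrite (pa (node m i.+1)); last by lra.
  rewrite (pa (node m i.+2)); last by lra.
  by rewrite n1 n2; field; rewrite gt_eqF.
have [xb|xb] := leP (b + mesh m) (node m i.+1).
  have -> : second_difference m p i = 0; last by rewrite !mulr0.
  rewrite /second_difference (pb (node m i)); last by lra.
  rewrite (pb (node m i.+1)); last by lra.
  rewrite (pb (node m i.+2)); last by lra.
  by rewrite n1 n2; field; rewrite gt_eqF.
by rewrite ler_wpM2r// Qd; lra.
Unshelve. all: by end_near. Qed.

(** The tent is piecewise linear with its only kink at 0, which is a node since
    the number of intervals is even. *)
Lemma tent_dirichlet_form n g :
  dirichlet_form n.*2.+1 (fun x => 1 - `|x| / c) g =
  (2 * g 0 - g (- c) - g c) / c.
Proof.
set m := n.*2.+1.
have n0 := node0 m; have nm := nodeN m.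
have mid : node m n.+1 = 0.
  rewrite /node /unif_node /m -[n.*2.+2]doubleS -muln2 natrM.
  have : n.+1%:R != 0 :> R by rewrite pnatr_eq0.
  by move: (n.+1%:R) => q q0; field.
have nle i j : (i <= j)%N -> node m i <= node m j.
  move=> ij; rewrite /node /unif_node lerD2l ler_pM2r ?mesh_gt0//.
  by rewrite ler_nat.
have mm : m.+1 = (n.+1 + n.+1)%N by rewrite /m addnn doubleS.
rewrite /dirichlet_form (@big_cat_nat _ _ _ n.+1)//=; last by rewrite mm leq_addr.
have m0 : mesh m != 0 by rewrite gt_eqF ?mesh_gt0.
have -> : \sum_(0 <= i < n.+1) (1 - `|node m i.+1| / c - (1 - `|node m i| / c)) *
     (g (node m i.+1) - g (node m i)) / mesh m =
   c^-1 * \sum_(0 <= i < n.+1) (g (node m i.+1) - g (node m i)).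
  rewrite mulr_sumr big_nat [RHS]big_nat; apply: eq_bigr => i /= iln.
  have i0 : node m i <= 0 by rewrite -mid nle// ltnW.
  have iS0 : node m i.+1 <= 0 by rewrite -mid nle.
  rewrite (ler0_norm i0) (ler0_norm iS0) nodeS; field.
  by rewrite m0 gt_eqF.
have -> : \sum_(n.+1 <= i < m.+1) (1 - `|node m i.+1| / c - (1 - `|node m i| / c)) *
     (g (node m i.+1) - g (node m i)) / mesh m =
   - c^-1 * \sum_(n.+1 <= i < m.+1) (g (node m i.+1) - g (node m i)).
  rewrite mulr_sumr big_nat [RHS]big_nat; apply: eq_bigr => i /= /andP[nli _].
  have i0 : 0 <= node m i by rewrite -mid nle.
  have iS0 : 0 <= node m i.+1 by rewrite -mid nle// leqW.
  rewrite (ger0_norm i0) (ger0_norm iS0) nodeS; field.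
  by rewrite m0 gt_eqF.
rewrite !telescope_sumr//; last by rewrite mm leq_addr.
by rewrite n0 nm mid; field; rewrite gt_eqF.
Qed.

End DirichletForm.

(** * Quantitative consequences of concavity *)

Section Bends.
Context {R : realType}.
Notation leb := (@lebesgue_measure R).
Implicit Types (lo hi x y z p q e : R) (r s rc Q B f g : R -> R).

Lemma concave_lipschitz lo hi r p q x y : concave_on `[lo, hi] r ->
  lo < p -> q < hi -> p <= x <= q -> p <= y <= q ->
  `|r y - r x| <= (`|right_derivative r p| + `|right_derivative r q|) * `|y - x|.
Proof.
move=> rc lop qhi.
wlog xy : x y / x <= y => [wl xI yI|].
  have [xy|/ltW yx] := leP x y; first exact: wl.
  by rewrite distrC [leRHS](_ : _ = (`|right_derivative r p| +
    `|right_derivative r q|) * `|x - y|) ?wl// distrC.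
move=> /andP[px xq] /andP[py yq].
have xI : lo < x < hi by lra.
have yI : lo < y < hi by lra.
have tx := concave_tangent rc xI (y := y) ltac:(lra).
have ty := concave_tangent rc yI (y := x) ltac:(lra).
have spx := right_derivative_nonincreasing rc lop px (proj2 (andP xI)).
have syq := right_derivative_nonincreasing rc (proj1 (andP yI)) yq qhi.
have N (u : R) : u <= `|u| /\ - u <= `|u|.
  by split; [exact: ler_norm|rewrite -normrN ler_norm].
have [? ?] := N (right_derivative r p); have [? ?] := N (right_derivative r q).
rewrite (@ger0_norm _ (y - x)) ?subr_ge0// ler_norml; apply/andP; split; nra.
Qed.

(** If the slope were constant on the open interval, r would be affine there, and
    by continuity up to its endpoints.  The continuous extension rc covers the
    case where x - h or x + h is an endpoint of [lo, hi]. *)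
Lemma concave_strict_midpoint_bend lo hi r rc x h : concave_on `[lo, hi] r ->
  continuous rc -> {in `[lo, hi], rc =1 r} ->
  0 < h -> lo <= x - h -> x + h <= hi -> r (x - h) + r (x + h) < 2 * r x ->
  exists p q, [/\ x - h < p, p < q, q < x + h &
    right_derivative r q < right_derivative r p].
Proof.
move=> rconc crc rcE h0 lox xhi rlt; apply: contrapT => nbend.
pose s := right_derivative r x.
have sle p q : x - h < p -> p < q -> q < x + h ->
    right_derivative r p <= right_derivative r q.
  move=> hp pq qh; rewrite leNgt; apply/negP => qp.
  by apply: nbend; exists p, q.
pose f t := rc (x + t) + rc (x - t) - 2 * rc x.
have cf : continuous f.
  move=> t; apply: cvgB; last exact: cvg_cst.
  apply: cvgD.
    apply: (cvg_comp (fun t => x + t) rc); last exact: crc.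
    by apply: cvgD; [exact: cvg_cst|exact: cvg_id].
  apply: (cvg_comp (fun t => x - t) rc); last exact: crc.
  by apply: cvgB; [exact: cvg_cst|exact: cvg_id].
have f0 t : 0 < t < h -> f t = 0.
  move=> /andP[t0 th]; rewrite /f !rcE ?in_itv/=; try lra.
  have t1 := @concave_tangent _ lo hi r x (x + t) rconc ltac:(lra) ltac:(lra).
  have t2 := @concave_tangent _ lo hi r (x + t) x rconc ltac:(lra) ltac:(lra).
  have t3 := @concave_tangent _ lo hi r x (x - t) rconc ltac:(lra) ltac:(lra).
  have t4 := @concave_tangent _ lo hi r (x - t) x rconc ltac:(lra) ltac:(lra).
  have s1 := sle (x - t) x ltac:(lra) ltac:(lra) ltac:(lra).
  have s2 := sle x (x + t) ltac:(lra) ltac:(lra) ltac:(lra).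
  by apply/eqP; rewrite eq_le; apply/andP; split; nra.
have : f h = 0.
  have fh : f t @[t --> h^'-] --> f h by exact/cvg_at_left_filter/cf.
  have fh0 : f t @[t --> h^'-] --> (0 : R).
    apply: cvg_near_cst; near=> t; apply: f0; apply/andP; split; near: t.
      exact: nbhs_left_gt.
    exact: nbhs_left_lt.
  exact: (cvg_unique _ fh fh0).
rewrite /f !rcE ?in_itv/=; try lra.
Unshelve. all: by end_near. Qed.

(** A difference of concave functions is Lipschitz near an interior point, so a
    nonzero value there makes the integral of the square positive. *)
Lemma concave_eq_of_integral c r s : 0 < c -> concave_on `[- c, c] r ->
  concave_on `[- c, c] s -> r c = s c -> r (- c) = s (- c) ->
  \int[leb]_(u in `[- c, c]) ((r u - s u) ^+ 2) <= 0 ->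
  {in `[- c, c], r =1 s}.
Proof.
move=> c0 rc sc rsc rsNc int0 x; rewrite in_itv/= => /andP[cx xc].
have [->//|xNc] := eqVneq x (- c); have [->//|xNc'] := eqVneq x c.
have {cx xNc}cx : - c < x by rewrite lt_neqAle eq_sym xNc.
have {xc xNc'}xc : x < c by rewrite lt_neqAle xNc'.
apply: contrapT => /eqP; rewrite -subr_eq0 => d0.
pose f u := r u - s u; rewrite -/(f x) in d0.
pose p := (x - c) / 2; pose q := (x + c) / 2.
(* The final 1 keeps K positive, for the division in d. *)
pose K := (`|right_derivative r p| + `|right_derivative r q|) +
  (`|right_derivative s p| + `|right_derivative s q|) + 1.
have K1 : 1 <= K by rewrite lerDr !addr_ge0.
have fL y : p <= y <= q -> `|f y - f x| <= K * `|y - x|.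
  move=> yI; have xI : p <= x <= q by rewrite /p /q; lra.
  have cp : - c < p by rewrite /p; lra.
  have qc : q < c by rewrite /q; lra.
  rewrite (_ : f y - f x = (r y - r x) - (s y - s x)); last by rewrite /f; ring.
  have H1 := concave_lipschitz rc cp qc xI yI.
  have H2 := concave_lipschitz sc cp qc xI yI.
  apply: (le_trans (ler_normB _ _)); apply: (le_trans (lerD H1 H2)).
  by rewrite -mulrDl ler_wpM2r// /K lerDl.
have fx0 : 0 < `|f x| by rewrite normr_gt0.
pose d := Num.min ((c - `|x|) / 2) (`|f x| / (2 * K)).
have xc' : `|x| < c by rewrite ltr_norml cx.
have d_gt0 : 0 < d.
  by rewrite lt_min !divr_gt0 ?subr_gt0// mulr_gt0//; lra.
have dle1 : d <= (c - `|x|) / 2 by rewrite ge_min lexx.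
have dle2 : K * d <= `|f x| / 2.
  have -> : `|f x| / 2 = K * (`|f x| / (2 * K)) by field; rewrite gt_eqF//; lra.
  by rewrite ler_pM2l; [rewrite ge_min lexx orbT|lra].
have [xn1 xn2] : x <= `|x| /\ - x <= `|x|.
  by split; [exact: ler_norm|rewrite -normrN ler_norm].
have fge u : x - d <= u <= x + d -> `|f x| ^+ 2 / 4 <= f u ^+ 2.
  move=> uI; have H := fL u ltac:(rewrite /p /q; lra).
  have ud : `|u - x| <= d by rewrite ler_distl.
  have H2 : `|f u - f x| <= `|f x| / 2.
    by apply: (le_trans H); apply: le_trans dle2; rewrite ler_pM2l//; lra.
  have H3 : `|f x| / 2 <= `|f u|.
    have := ler_normB (f u) (f u - f x); rewrite opprB addrC subrK.
    lra.
  rewrite -[f u ^+ 2]real_normK ?num_real//.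
  have -> : `|f x| ^+ 2 / 4 = (`|f x| / 2) ^+ 2 by field.
  by rewrite ler_sqr ?nnegrE// divr_ge0.
have fi : leb.-integrable `[- c, c] (EFin \o (fun u => f u ^+ 2)).
  exact: concave_sqrB_integrable.
have i1 : leb.-integrable `[- c, (x + d)] (EFin \o (fun u => f u ^+ 2)).
  apply: integrableS fi => // u /=; rewrite !in_itv/= => /andP[-> /=] ux.
  by apply: (le_trans ux); lra.
have i2 : leb.-integrable `[x - d, (x + d)] (EFin \o (fun u => f u ^+ 2)).
  apply: integrableS i1 => // u /=; rewrite !in_itv/= => /andP[ux ->].
  by rewrite andbT; apply: le_trans ux; lra.
have nn a b : 0 <= \int[leb]_(u in `[a, b]) (f u ^+ 2).
  by apply: Rintegral_ge0 => u _; exact: sqr_ge0.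
have E1 := @Rintegral_chasles _ (fun u => f u ^+ 2) (- c) (x + d) c ltac:(lra) ltac:(lra) fi.
have E2 := @Rintegral_chasles _ (fun u => f u ^+ 2) (- c) (x - d) (x + d) ltac:(lra) ltac:(lra) i1.
have pos : 0 < \int[leb]_(u in `[x - d, x + d]) (f u ^+ 2).
  apply: (@lt_le_trans _ _ (\int[leb]_(u in `[x - d, x + d]) cst (`|f x| ^+ 2 / 4) u)).
    rewrite Rintegral_cst//= lebesgue_measure_itv/= lte_fin ifT; last by lra.
    have h2 : 0 < `|f x| ^+ 2 / 4 by rewrite divr_gt0// exprn_gt0.
    by rewrite mulr_gt0//=; lra.
  apply: le_Rintegral => //.
  by apply: continuous_integrable => ?; exact: cvg_cst.
move: int0; rewrite -/(\int[leb]_(u in `[- c, c]) (f u ^+ 2)) E1 E2.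
by apply/negP; rewrite -ltNge ltr_wpDr ?nn// ltr_wpDl ?nn.
Qed.

End Bends.

(** * Vanishing of the Dirichlet form *)

Section DirichletFormVanishing.
Context {R : realType}.
Variable c : R.
Hypothesis c0 : 0 < c.

Lemma dirichlet_formBl m (f g r : R -> R) (a : R) :
  dirichlet_form c m (fun x => f x - a * g x) r =
  dirichlet_form c m f r - a * dirichlet_form c m g r.
Proof.
rewrite /dirichlet_form mulr_sumr -sumrB; apply: eq_bigr => i _; ring.
Qed.

Lemma dirichlet_formBDr m (f r s p : R -> R) :
  dirichlet_form c m f (fun x => r x - s x + p x) =
  dirichlet_form c m f r - dirichlet_form c m f s + dirichlet_form c m f p.
Proof.
rewrite /dirichlet_form -sumrB -big_split/=; apply: eq_bigr => i _; ring.
Qed.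

(** If the second difference at a node is nonzero, r bends within one mesh of the
    node, so Q vanishes nearby and |Q| is at most K times the mesh at the node
    itself.  The form is then bounded by K times the sum of the undivided
    second differences, which is the difference of the first and the last
    increment of r and tends to 0 by continuity at the endpoints, even if the
    slopes there are infinite. *)
Lemma dirichlet_form_cvg0 (Q r rc : R -> R) (K : R) : Q (- c) = 0 -> Q c = 0 ->
  concave_on `[- c, c] r -> continuous rc -> {in `[- c, c], rc =1 r} ->
  (forall x y, - c <= x <= c -> - c <= y <= c -> `|Q y - Q x| <= K * `|y - x|) ->
  (forall x y, - c < x -> x < y -> y < c ->
     right_derivative r y < right_derivative r x ->
     exists2 z, x <= z <= y & Q z = 0) ->
  dirichlet_form c m Q r @[m --> \oo] --> (0 : R).
Proof.
move=> QNc Qc rconc crc rcE QK Qz; have cgt0 := c0.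
have K0 : 0 <= K.
  have := QK (- c) c ltac:(lra) ltac:(lra).
  rewrite QNc Qc subrr normr0 opprK ger0_norm; last by lra.
  have c20 : 0 < c + c by lra.
  by rewrite (pmulr_lge0 _ c20).
pose h m : R := (c - - c) / m.+1%:R.
have h_gt0 m : 0 < h m by rewrite divr_gt0// opprK addr_gt0.
have hcvg : h m @[m --> \oo] --> (0 : R) by exact: unif_mesh_cvg0.
pose b m := K * ((rc (- c + h m) - rc (- c)) - (rc c - rc (c - h m))).
have bcvg : b m @[m --> \oo] --> (0 : R).
  rewrite (_ : 0 = K * ((rc (- c + 0) - rc (- c)) - (rc c - rc (c - 0)))); last first.
    by rewrite addr0 subr0 !subrr mulr0.
  apply: cvgMr; apply: cvgB; apply: cvgB; try exact: cvg_cst.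
    apply: (cvg_comp _ rc); last exact: crc.
    by apply: cvgD => //; exact: cvg_cst.
  apply: (cvg_comp _ rc); last exact: crc.
  by apply: cvgB => //; exact: cvg_cst.
suff H m : `|dirichlet_form c m Q r| <= b m.
  apply/cvgrPdist_lt => e e0; move/cvgrPdist_lt : bcvg => /(_ e e0).
  apply: filterS => m; rewrite !sub0r !normrN => bm.
  by rewrite (le_lt_trans (H m))// (le_lt_trans (ler_norm _)).
pose nd := unif_node (- c) c m.+1.
have nd0 : nd 0%N = - c by exact: unif_node0.
have ndN : nd m.+1 = c by exact: unif_nodeN.
have ndS i : nd i.+1 = nd i + h m by exact: unif_nodeS.
have nd_in i : (i <= m.+1)%N -> - c <= nd i <= c by apply: unif_node_in; lra.
have -> : b m = \sum_(0 <= i < m) (K * h m) * second_difference c m r i.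
  rewrite -mulr_sumr sum_second_difference.
  rewrite -/(nd 0%N) -/(nd 1%N) -/(nd m.+1) -/(nd m) -/(h m).
  rewrite -!rcE ?in_itv/= ?nd_in// (ndS 0%N) nd0 ndN.
  have -> : nd m = c - h m by rewrite -ndN ndS addrK.
  by rewrite /b; field; rewrite gt_eqF.
rewrite dirichlet_form_abel// (le_trans (ler_norm_sum _ _ _))//.
rewrite big_nat [leRHS]big_nat; apply: ler_sum => i /= im.
have w0 := second_difference_ge0 c0 rconc im.
rewrite normrM (ger0_norm w0) -/(nd i.+1).
have [->|wn0] := eqVneq (second_difference c m r i) 0; first by rewrite !mulr0.
rewrite ler_wpM2r//.
have {wn0 w0}w0 : 0 < second_difference c m r i by rewrite lt_neqAle eq_sym wn0.
have i1 := nd_in i.+1 (leqW im).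
have i0 := nd_in i (leqW (ltnW im)).
have i2 := nd_in i.+2 im.
have n0 : nd i = nd i.+1 - h m by rewrite ndS addrK.
have n2 : nd i.+2 = nd i.+1 + h m by rewrite ndS.
have [x [y [hx xy yh sxy]]] : exists p q,
    [/\ nd i.+1 - h m < p, p < q, q < nd i.+1 + h m &
    right_derivative r q < right_derivative r p].
  apply: (concave_strict_midpoint_bend rconc crc rcE) => //; try lra.
  rewrite -n0 -n2; move: w0; rewrite /second_difference.
  rewrite -/(nd i) -/(nd i.+1) -/(nd i.+2) pmulr_lgt0 ?invr_gt0 ?h_gt0//; lra.
have [|||z zI Qz0] := Qz x y _ _ _ sxy => //; try lra.
have := QK z (nd i.+1) ltac:(lra) i1; rewrite Qz0 subr0 => /le_trans; apply.
by rewrite ler_wpM2l// ler_distl; lra.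
Qed.

End DirichletFormVanishing.

(** * The multiplier criterion *)

Section OptimalityCriterion.
Context {R : realType}.
Notation leb := (@lebesgue_measure R).
Variables (c k gam : R) (X rhat rc G B : R -> R).
Hypotheses (c0 : 0 < c) (cX : continuous X) (C0 : concave_class c k rhat).
Hypotheses (crc : continuous rc) (rcE : {in `[- c, c], rc =1 rhat}).
Hypothesis dG : forall x : R, is_derive x 1 G (rc x).
Hypothesis dB : forall x : R, is_derive x 1 B (G x - X x - gam).
Hypotheses (BNc : B (- c) = 0) (Bc : B c = 0).

Let tent (x : R) : R := 1 - `|x| / c.
Let Lam r := RS_integral (G \- X) r (- c) c.
Let cc : - c < c. Proof. by rewrite -subr_gt0 opprK addr_gt0. Qed.

Lemma tent_Nc : tent (- c) = 0.
Proof. by rewrite /tent normrN gtr0_norm// divff ?subrr// gt_eqF. Qed.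

Lemma tent_c : tent c = 0.
Proof. by rewrite /tent gtr0_norm// divff ?subrr// gt_eqF. Qed.

Lemma tent_gt0 x : - c < x < c -> 0 < tent x.
Proof. by move=> xc; rewrite subr_gt0 ltr_pdivrMr// mul1r ltr_norml. Qed.

Lemma tent_continuous : continuous tent.
Proof.
move=> x; apply: cvgB; first exact: cvg_cst.
by apply: cvgMl; exact: norm_continuous.
Qed.

Lemma is_RS_integral_Lam r : concave_class c k r ->
  is_RS_integral (G \- X) r (- c) c (Lam r).
Proof.
move=> [rconc _ _ _].
have [I HI] := concave_is_RS_integral c0 cX rconc.
have HG := concave_by_parts c0 crc dG rconc.
have H := is_RS_integralBl HG HI.
by rewrite /Lam (RS_integralE cc H).
Qed.

Lemma dirichlet_form_cvg_Lam r : concave_class c k r ->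
  dirichlet_form c n.*2.+1 B r @[n --> \oo] --> Lam r.
Proof.
move=> C; have [_ _ rck rNck] := C.
have H := is_RS_integralBl (is_RS_integral_Lam C) (is_RS_integral_cst gam r (- c) c).
rewrite rck rNck subrr mulr0 subr0 in H.
have := dirichlet_form_cvg c0 dB H.
apply: (cvg_comp (fun n => n.*2.+1) (fun m => dirichlet_form c m B r)).
exact: cvg_odd_nat.
Qed.

Lemma tent_form_class n r : concave_class c k r ->
  dirichlet_form c n.*2.+1 tent r = - (2 * k / c).
Proof.
move=> [_ r0 rck rNck]; rewrite tent_dirichlet_form// r0 rck rNck.
by field; rewrite gt_eqF.
Qed.

Lemma phi_Lam r : concave_class c k r ->
  phi X c r - phi X c rhat =
    2^-1 * \int[leb]_(u in `[- c, c]) ((r u - rhat u) ^+ 2) - (Lam r - Lam rhat).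
Proof. exact: phi_expansion c0 cX crc dG rcE C0. Qed.

Lemma lipschitz_B : exists2 K : R, 0 <= K & forall x y,
  - c <= x <= c -> - c <= y <= c -> `|B y - B x| <= K * `|y - x|.
Proof.
have cE : continuous (fun x => G x - X x - gam).
  move=> x; apply: cvgB; last exact: cvg_cst.
  by apply: cvgB; [exact: (is_derive_continuous dG)|exact: cX].
have [M0 [_ HM0]] : bounded_set ((fun x => G x - X x - gam) @` `[- c, c]).
  apply: compact_bounded; apply: continuous_compact; last exact: segment_compact.
  exact: continuous_subspaceT.
pose M := `|M0| + 1; exists M; first by rewrite addr_ge0.
have HM x : - c <= x <= c -> `|G x - X x - gam| <= M.
  move=> xab; apply: HM0; last by exists x => //=; rewrite in_itv.
  by rewrite (le_lt_trans (ler_norm _))// ltrDl.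
move=> x y; wlog xy : x y / x <= y => [wl xI yI|xI yI].
  have [xy|/ltW yx] := leP x y; first exact: wl.
  by rewrite distrC [`|y - x|]distrC wl.
have cB := is_derive_continuous dB.
have [z] := MVT_segment xy (fun x _ => dB x) (continuous_subspaceT cB).
rewrite in_itv/= => zI ->; rewrite normrM ler_wpM2r// HM//.
by move: xI yI zI => /andP[? ?] /andP[? ?] /andP[? ?]; apply/andP; split; lra.
Qed.

Lemma lipschitz_sub_tent lam : exists K : R, forall x y,
  - c <= x <= c -> - c <= y <= c ->
  `|(B y - lam * tent y) - (B x - lam * tent x)| <= K * `|y - x|.
Proof.
have [K _ HK] := lipschitz_B; exists (K + `|lam| / c) => x y xI yI.
rewrite (_ : _ - _ = (B y - B x) + lam / c * (`|y| - `|x|)); last first.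
  by rewrite /tent; field; rewrite gt_eqF.
rewrite (le_trans (ler_normD _ _))// mulrDl lerD// ?HK// normrM.
rewrite ler_pM//; last by rewrite ler_dist_dist.
by rewrite normrM (@gtr0_norm _ c^-1) ?invr_gt0.
Qed.

(** The Dirichlet form of the tent is the same for all members of the class.
    Hence the integral of any competitor is at most - lam * (2 k / c), the value
    taken at rhat.  Uniqueness comes from the quadratic term of phi. *)
Lemma argmin_of_multiplier lam :
  (forall x, - c <= x <= c -> B x <= lam * tent x) ->
  (forall x y, - c < x -> x < y -> y < c ->
     right_derivative rhat y < right_derivative rhat x ->
     exists2 z, x <= z <= y & B z = lam * tent z) ->
  is_argmin `[- c, c] (concave_class c k) (phi X c) rhat.
Proof.
move=> Ble Beq.
pose Q x := B x - lam * tent x.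
have QNc : Q (- c) = 0 by rewrite /Q BNc tent_Nc mulr0 subrr.
have Qc : Q c = 0 by rewrite /Q Bc tent_c mulr0 subrr.
have Q0 x : - c <= x <= c -> Q x <= 0 by move=> xI; rewrite subr_le0 Ble.
have formE n r : concave_class c k r ->
    dirichlet_form c n.*2.+1 B r = dirichlet_form c n.*2.+1 Q r - lam * (2 * k / c).
  by move=> C; rewrite dirichlet_formBl tent_form_class//; ring.
have Lam_le r : concave_class c k r -> Lam r <= - (lam * (2 * k / c)).
  move=> C; apply: (cvgr_to_le (dirichlet_form_cvg_Lam C)); near=> n.
  rewrite formE// gerDr; have [rconc _ _ _] := C.
  exact: dirichlet_form_nonpos.
have Lam0 : Lam rhat = - (lam * (2 * k / c)).
  have [rconc _ _ _] := C0.
  have [K HK] := lipschitz_sub_tent lam.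
  have Qz x y : - c < x -> x < y -> y < c ->
     right_derivative rhat y < right_derivative rhat x ->
     exists2 z, x <= z <= y & Q z = 0.
    move=> cx xy yc sxy; have [z zI zE] := Beq x y cx xy yc sxy.
    by exists z => //; rewrite /Q zE subrr.
  have := dirichlet_form_cvg0 c0 QNc Qc rconc crc rcE HK Qz.
  move=> /(cvg_comp (fun n => n.*2.+1) (fun m => dirichlet_form c m Q rhat)).
  move=> /(_ _ cvg_odd_nat) H0.
  have H1 : dirichlet_form c n.*2.+1 B rhat @[n --> \oo] --> 0 - lam * (2 * k / c).
    have -> : (fun n => dirichlet_form c n.*2.+1 B rhat) =
        (fun n => dirichlet_form c n.*2.+1 Q rhat - lam * (2 * k / c)).
      by apply/funext => n; rewrite formE.
    by apply: cvgB => //; exact: cvg_cst.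
  by rewrite (cvg_unique _ (dirichlet_form_cvg_Lam C0) H1)// sub0r.
have int_ge0 r : 0 <= \int[leb]_(u in `[- c, c]) ((r u - rhat u) ^+ 2).
  by apply: Rintegral_ge0 => u _; exact: sqr_ge0.
split => //.
- move=> r C; have := phi_Lam C; have := Lam_le r C; rewrite -Lam0 => H1 H2.
  rewrite -subr_ge0 H2 subr_ge0 (@le_trans _ _ 0)//; first by rewrite subr_le0.
  by rewrite mulr_ge0// invr_ge0.
- move=> r C rmin; have [rconc _ rck rNck] := C.
  have [r0conc _ r0ck r0Nck] := C0.
  have rr0 : {in `[- c, c], r =1 rhat}.
    apply: concave_eq_of_integral c0 rconc r0conc _ _ _; rewrite ?rck ?rNck//.
    have := phi_Lam C; have := Lam_le r C; rewrite -Lam0 => H1 H2.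
    have := rmin rhat C0; move: H2; set I := Rintegral _ _ _.
    by move=> H2 H3; lra.
  by move=> x; rewrite inE/=; exact: rr0.
Unshelve. all: by end_near. Qed.

(** First-order optimality: along the segment from rhat to r the linear term
    dominates the quadratic one. *)
Lemma argmin_Lam_le r : is_argmin `[- c, c] (concave_class c k) (phi X c) rhat ->
  concave_class c k r -> Lam r <= Lam rhat.
Proof.
move=> [_ rmin _] C; have [r0conc r00 r0ck r0Nck] := C0; have [rconc r0 rck rNck] := C.
pose re e x := (1 - e) * rhat x + e * r x.
have reC e : 0 <= e <= 1 -> concave_class c k (re e).
  move=> eI; split; first exact: concave_conv.
  - by rewrite /re r00 r0 !mulr0 addr0.
  - by rewrite /re r0ck rck; ring.
  - by rewrite /re r0Nck rNck; ring.
have LamE e : 0 <= e <= 1 -> Lam (re e) - Lam rhat = e * (Lam r - Lam rhat).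
  move=> eI; have := is_RS_integralD (is_RS_integralZ (1 - e) (is_RS_integral_Lam C0))
    (is_RS_integralZ e (is_RS_integral_Lam C)).
  move=> /(RS_integralE cc); rewrite -/(Lam _) => H.
  by rewrite [Lam (re e)]H; ring.
set N := \int[leb]_(u in `[- c, c]) ((r u - rhat u) ^+ 2).
(* Optimality of rhat against (1 - e) rhat + e r, divided by e. *)
have key e : 0 < e <= 1 -> Lam r - Lam rhat <= e * (2^-1 * N).
  move=> /andP[e0 e1]; have eI : 0 <= e <= 1 by rewrite ltW.
  have := rmin _ (reC e eI); rewrite -subr_ge0 (phi_Lam (reC e eI)) LamE//.
  have -> : \int[leb]_(u in `[- c, c]) ((re e u - rhat u) ^+ 2) = e ^+ 2 * N.
    rewrite /N -RintegralZl//; last exact: concave_sqrB_integrable.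
    by apply: eq_Rintegral => u _; rewrite /re; ring.
  by rewrite subr_ge0 -[leRHS](_ : e * (e * (2^-1 * N)) = _) ?ler_pM2l//; ring.
rewrite -subr_le0 leNgt; apply/negP => D0.
have N0 : 0 < 2^-1 * N by apply: (lt_le_trans D0); rewrite -[leRHS]mul1r key// ltr01 lexx.
pose D := Lam r - Lam rhat; rewrite -/D in D0.
have := key (Num.min 1 (D / (2 * (2^-1 * N)))).
rewrite lt_min ltr01 ge_min lexx /= divr_gt0 ?(mulr_gt0 _ N0)// => /(_ isT).
rewrite -/D; apply/negP; rewrite -ltNge.
apply: (@le_lt_trans _ _ (D / (2 * (2^-1 * N)) * (2^-1 * N))).
  by rewrite ler_pM2r// ge_min lexx orbT.
have -> : D / (2 * (2^-1 * N)) * (2^-1 * N) = D / 2.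
  by move: (2^-1 * N) N0 => M M0; field; rewrite gt_eqF.
lra.
Qed.

(** If B z / T z were smaller than B t / T t, with T the tent, then trading
    curvature at z for curvature at t would pay: rho carries the curvature of
    rhat near z, and it is replaced by the function p with a single kink at t
    and the same values at - c, 0 and c.  With mu = B t / T t, the integrals of p
    and rho differ by the Dirichlet forms of Q = B - mu T, and Q vanishes
    at t but is negative near z. *)
Lemma argmin_bend_le t z : is_argmin `[- c, c] (concave_class c k) (phi X c) rhat ->
  - c < t < c -> - c < z < c ->
  is_bend (- c) c rhat z ->
  B t * tent z <= B z * tent t.
Proof.
move=> rmin tI zI bend; rewrite leNgt; apply/negP => Blt.
have [r0conc r00 r0ck r0Nck] := C0.
have Tt := tent_gt0 tI; have Tz := tent_gt0 zI.
pose mu := B t / tent t.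
pose Q x := B x - mu * tent x.
have QNc : Q (- c) = 0 by rewrite /Q BNc tent_Nc mulr0 subrr.
have Qc : Q c = 0 by rewrite /Q Bc tent_c mulr0 subrr.
have Qt : Q t = 0 by rewrite /Q /mu mulfVK ?subrr// gt_eqF.
pose eta := - Q z / 2.
have eta0 : 0 < eta.
  rewrite divr_gt0// oppr_gt0 /Q /mu subr_lt0 mulrAC ltr_pdivlMr//.
have cQ : continuous Q.
  move=> x; apply: cvgB; first exact: (is_derive_continuous dB).
  by apply: cvgMr; exact: tent_continuous.
have [d d0 Hd] : exists2 d, 0 < d & forall x, z - d < x < z + d -> Q x <= - eta.
  have /cvgrPdist_lt/(_ _ eta0)/nbhs_ballP[d/= d0 Hd] := cQ z.
  exists d => // x xI; have : `|Q z - Q x| < eta.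
    by apply: Hd; rewrite /ball/= ltr_distlC.
  by rewrite ltr_norml => /andP[+ _]; rewrite /eta; lra.
have d20 : 0 < d / 2 by rewrite divr_gt0.
have [a [b [za ab bz [ca bc] sab]]] := bend (d / 2) d20.
pose m := right_derivative rhat a - right_derivative rhat b.
have m0 : 0 < m by rewrite subr_gt0.
have [rho [rhoc rrhoc rhoa rhob]] := concave_localize r0conc ca ab bc.
pose th := rho 0 - (rho c + rho (- c)) / 2.
have th0 : 0 <= th.
  have /concave_onP/(_ (- c) c (2^-1)) := rhoc.
  rewrite (_ : 2^-1 * - c + (1 - 2^-1) * c = 0); last by field.
  rewrite !lexx (ltW cc)/= invr_ge0 ler0n invf_le1 ?ler1n//= => /(_ isT isT isT).
  rewrite /th; lra.
(* kap, bet and the constant term are determined by the values of rho at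
   - c, 0 and c; kap >= 0 because rho is concave. *)
pose kap := th / (c - `|t|).
have ct0 : 0 < c - `|t| by rewrite subr_gt0 ltr_norml.
have kap0 : 0 <= kap by rewrite divr_ge0// ltW.
pose bet := (rho c - rho (- c) + kap * (`|c - t| - `|- c - t|)) / (2 * c).
pose p x := rho 0 + bet * x - kap * (`|x - t| - `|t|).
have nct : `|c - t| = c - t by rewrite ger0_norm// subr_ge0 ltW//; case/andP: tI.
have nNct : `|- c - t| = c + t.
  by rewrite -normrN opprB opprK addrC ger0_norm//; move: tI; lra.
have p0 : p 0 = rho 0 by rewrite /p sub0r normrN subrr !mulr0 addr0 subr0.
have kapE : kap * (c - `|t|) = th by rewrite mulfVK ?gt_eqF.
have pc : p c = rho c.
  have -> : p c = rho 0 + bet * c - kap * (`|c - t| - c) - kap * (c - `|t|).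
    by rewrite /p; ring.
  by rewrite kapE /bet nct nNct /th; field; rewrite gt_eqF.
have pNc : p (- c) = rho (- c).
  have -> : p (- c) = rho 0 - bet * c - kap * (`|- c - t| - c) - kap * (c - `|t|).
    by rewrite /p; ring.
  by rewrite kapE /bet nct nNct /th; field; rewrite gt_eqF.
have pconc : concave_on `[- c, c] p.
  apply/concave_onP => x y s _ _ /andP[s0 s1].
  have H : `|s * x + (1 - s) * y - t| <= s * `|x - t| + (1 - s) * `|y - t|.
    rewrite (_ : _ - t = s * (x - t) + (1 - s) * (y - t)); last by ring.
    rewrite (le_trans (ler_normD _ _))// !normrM (ger0_norm s0).
    by rewrite (@ger0_norm _ (1 - s)) ?subr_ge0.
  have := ler_wpM2l kap0 H; rewrite /p; lra.
pose r x := rhat x - rho x + p x.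
have C : concave_class c k r.
  split; first exact: concave_onD.
  - by rewrite /r p0 subrK.
  - by rewrite /r pc subrK.
  - by rewrite /r pNc subrK.
have := argmin_Lam_le rmin C; apply/negP; rewrite -ltNge -subr_gt0.
(* The kink of p at t has size 2 kap and Q t = 0, so p loses at most
   e * (2 kap) <= eta * m / 2, while removing rho gains eta * m. *)
pose e := eta * m / (4 * (kap + 1)).
have kap1 : 0 < kap + 1 by rewrite ltr_wpDl.
have e0 : 0 < e by apply: divr_gt0; apply: mulr_gt0.
have [d' d'0 Hd'] : exists2 d, 0 < d & forall x, t - d < x < t + d -> - e <= Q x.
  have /cvgrPdist_lt/(_ _ e0)/nbhs_ballP[d'/= d'0 Hd'] := cQ t.
  exists d' => // x xI; have : `|Q t - Q x| < e.
    by apply: Hd'; rewrite /ball/= ltr_distlC.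
  by rewrite Qt ltr_norml => /andP[_]; lra.
have formp : \forall n \near \oo, (- e) * (2 * kap) <= dirichlet_form c n Q p.
  have /andP[tc1 tc2] := tI.
  rewrite (_ : 2 * kap = (bet + kap) - (bet - kap)); last by ring.
  apply: (@dirichlet_form_ge _ _ c0 t t _ _ _ d') => //.
  - move=> x /andP[_ xt]; rewrite /p subrr normr0 ler0_norm ?subr_le0//; ring.
  - move=> x /andP[tx _]; rewrite /p subrr normr0 ger0_norm ?subr_ge0//; ring.
  - by move=> x _; exact: Hd'.
have formrho : \forall n \near \oo, eta * m <= dirichlet_form c n (fun x => - Q x) rho.
  apply: (@dirichlet_form_ge _ _ c0 a b _ _ _ (d / 2)) => //; rewrite ?QNc ?Qc ?oppr0//.
  - move=> x xI; rewrite rhoa// rhoa; last by rewrite lexx ltW.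
    by rewrite subrr mulr0 addr0.
  - move=> x xI; rewrite rhob// rhob; last by rewrite lexx ltW.
    by rewrite subrr mulr0 addr0.
  - move=> x _ /andP[x1 x2]; rewrite lerNr; apply: Hd; lra.
have {}formp := cvg_odd_nat formp; have {}formrho := cvg_odd_nat formrho.
have lim : dirichlet_form c n.*2.+1 B r - dirichlet_form c n.*2.+1 B rhat
    @[n --> \oo] --> Lam r - Lam rhat.
  exact: cvgB (dirichlet_form_cvg_Lam C) (dirichlet_form_cvg_Lam C0).
apply: (@lt_le_trans _ _ (eta * m / 2)); first by rewrite divr_gt0// mulr_gt0.
apply: (cvgr_to_ge lim); near=> n.
have f1 : (- e) * (2 * kap) <= dirichlet_form c n.*2.+1 Q p by near: n.
have f2 : eta * m <= dirichlet_form c n.*2.+1 (fun x => - Q x) rho by near: n.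
have f2' : dirichlet_form c n.*2.+1 (fun x => - Q x) rho =
    - dirichlet_form c n.*2.+1 Q rho.
  by rewrite /dirichlet_form -sumrN; apply: eq_bigr => i _; ring.
have tp : dirichlet_form c n.*2.+1 tent p = dirichlet_form c n.*2.+1 tent rho.
  by rewrite !tent_dirichlet_form// p0 pc pNc.
have e2 : e * (2 * kap) <= eta * m / 2.
  rewrite /e -mulrA mulrCA.
  have em : 0 < eta * m by rewrite mulr_gt0.
  rewrite -subr_ge0 (_ : _ - _ = eta * m / (2 * (kap + 1))); last first.
    by field; rewrite gt_eqF.
  by rewrite divr_ge0 ?(ltW em)// mulr_ge0// ltW.
rewrite /= /r dirichlet_formBDr.
move: f1 f2; rewrite f2' !dirichlet_formBl tp; lra.
Unshelve. all: by end_near. Qed.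

End OptimalityCriterion.

(** * Second antiderivatives *)

Section SecondAntiderivatives.
Context {R : realType}.
Implicit Types (c x a : R) (F G H Y X B rhat : R -> R).

Lemma derive_zero_constant F c : {within `[- c, c], continuous F} ->
  (forall x, - c < x < c -> is_derive x 1 F 0) ->
  forall x y, - c <= x <= c -> - c <= y <= c -> F x = F y.
Proof.
move=> cF dF x y.
wlog xy : x y / x <= y => [wl xI yI|].
  have [xy|/ltW yx] := leP x y; first exact: wl.
  by apply/esym; apply: wl.
move=> /andP[cx xc] /andP[cy yc].
have dF' z : z \in `]x, y[ -> is_derive z 1 F ((fun=> 0) z : R).
  rewrite in_itv/= => /andP[xz zy]; apply: dF.
  by rewrite (le_lt_trans cx)//= (lt_le_trans zy).
have cF' : {within `[x, y], continuous F}.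
  apply: continuous_subspaceW cF => z /=; rewrite !in_itv/= => /andP[xz zy].
  by rewrite (le_trans cx)//= (le_trans zy).
have [z _] := MVT_segment xy dF' cF'.
by rewrite mul0r => /eqP; rewrite subr_eq0 => /eqP.
Qed.

(** Both sides have the second derivative rhat du - dX, understood through the
    first derivatives, whose difference is constant. *)
Lemma second_antiderivative_affine c a gam X G B rc rhat H Y : 0 < c ->
  {in `[- c, c], rc =1 rhat} ->
  (forall x, is_derive x 1 G (rc x)) ->
  (forall x, is_derive x 1 B (G x - X x - gam)) ->
  (forall x, is_derive x 1 Y (X x - a)) ->
  is_second_antiderivative rhat H (- c) c ->
  exists alpha beta, forall x, - c <= x <= c ->
    H x - Y x = B x + alpha + beta * x.
Proof.
move=> c0 rcE dG dB dY [G1 [LRG1 G1E] [LRH HE]].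
have cG := is_derive_continuous dG.
have cB := is_derive_continuous dB.
have cY := is_derive_continuous dY.
have dG1 x : - c < x < c -> is_derive x 1 G1 (rhat x).
  move=> xI; have xI' : x \in `]- c, c[ by rewrite in_itv.
  by rewrite -G1E// derive1E; apply: DeriveDef => //; have [+ _ _] := LRG1; apply.
have dH x : - c < x < c -> is_derive x 1 H (G1 x).
  move=> xI; have xI' : x \in `]- c, c[ by rewrite in_itv.
  by rewrite -HE// derive1E; apply: DeriveDef => //; have [+ _ _] := LRH; apply.
have cG1 := derivable_oo_LRcontinuous_within LRG1.
have cH := derivable_oo_LRcontinuous_within LRH.
have G1G x : - c <= x <= c -> G1 x - G x = G1 0 - G 0.
  move=> xI; apply: (@derive_zero_constant (G1 \- G) c) => //; last by lra.
    by move=> z; apply: cvgB; [exact: cG1|exact: (continuous_subspaceT cG)].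
  move=> z zI; rewrite -(subrr (rhat z)) -{2}rcE; last first.
    by rewrite in_itv/=; move: zI; lra.
  by apply: is_deriveB; exact: dG1.
pose beta := G1 0 - G 0 + a + gam.
pose F x := H x - Y x - B x - beta * x.
have FE x : - c <= x <= c -> F x = F 0.
  move=> xI; apply: (@derive_zero_constant F c) => //; last by lra.
    move=> z; apply: cvgB; [apply: cvgB; [apply: cvgB|]|].
    - exact: cH.
    - exact: (continuous_subspaceT cY).
    - exact: (continuous_subspaceT cB).
    - by apply: (@continuous_subspaceT _ _ _ ( *%R beta)); exact: mulrl_continuous.
  move=> z zI; have zI' : - c <= z <= c by move: zI; lra.
  have dz : is_derive z 1 ( *%R beta) (beta *: 1).
    by apply: is_deriveZ.
  have := dH z zI => dHz.
  have -> : 0 = G1 z - (X z - a) - (G z - X z - gam) - beta *: 1 :> R.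
    by rewrite /beta -(G1G z zI') [_ *: _]mulr1; ring.
  by apply: is_deriveB; apply: is_deriveB; apply: is_deriveB.
exists (F 0), beta => x xI; rewrite -(FE x xI) /F; ring.
Qed.

End SecondAntiderivatives.

(** * The curvature measure *)

Section BendMeasure.
Context {R : realType}.
Variables (c : R) (r : R -> R) (mu : {measure set (measurableTypeR R) -> \bar R}).
Hypotheses (rconc : concave_on `[- c, c] r) (mur : is_minus_dderiv c r mu).

(** Every point that is not a bend lies in an interval with rational endpoints on
    which the right derivative is constant, hence which has measure zero. *)
Lemma negligible_no_bend (Z : set (measurableTypeR R)) :
  (forall z, Z z -> - c < z < c -> ~ is_bend (- c) c r z) -> mu.-negligible Z.
Proof.
move=> Zb; have [muE mu0] := mur.
pose U (p q : R) : set (measurableTypeR R) :=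
  if `[< [/\ - c < p, p <= q, q < c & right_derivative r p = right_derivative r q] >]
  then `]p, q]%classic else set0.
pose F n := if @unpickle (rat * rat)%type n is Some pq
  then U (ratr pq.1) (ratr pq.2) else set0.
have mF n : mu.-negligible (F n).
  rewrite /F; case: unpickle => [pq|]; last exact: negligible_set0.
  rewrite /U; case: asboolP => [[cp pq' qc E]|_]; last exact: negligible_set0.
  move: (ratr pq.1) (ratr pq.2) cp pq' qc E => p q cp pq' qc E.
  exists `]p, q]%classic; split => //.
  by rewrite muE// E subrr.
have mc : mu.-negligible (~` `]- c, c[%classic : set (measurableTypeR R)).
  by exists (~` `]- c, c[%classic); split => //; apply: measurableC.
apply: (negligibleS _ (negligibleU mc (negligible_bigcup mF))) => z Zz.
have [zc|zc] := pselect (- c < z < c); last by left; rewrite /= in_itv.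
right; have [d d0 Hd] := not_bend (Zb z Zz zc).
have /andP[cz zc'] := zc.
have [p] : exists q : rat, ratr q \in `](Num.max (- c) (z - d)), z[.
  by apply: rat_in_itvoo; rewrite gt_max cz ltrBlDr ltrDl.
rewrite in_itv/= gt_max => /andP[/andP[cp dp] pz].
have [q] : exists q : rat, ratr q \in `]z, (Num.min c (z + d))[.
  by apply: rat_in_itvoo; rewrite lt_min zc' ltrDl.
rewrite in_itv/= lt_min => /andP[zq /andP[qc qd]].
have pq : (ratr p : R) < ratr q by exact: lt_trans zq.
exists (pickle (p, q)); first by [].
rewrite /F pickleK -[U _ _]/(U (ratr p) (ratr q)).
move: (ratr p) (ratr q) cp dp pz zq qc qd pq => {}p {}q cp dp pz zq qc qd pq.
rewrite /U asboolT; first by rewrite /= in_itv/= pz ltW.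
split => //; first exact: ltW.
apply/eqP; rewrite eq_le Hd//=.
by apply: (right_derivative_nonincreasing rconc) => //; exact: ltW.
Qed.

Lemma bend_interval_not_negligible x y : - c < x -> x < y -> y < c ->
  right_derivative r y < right_derivative r x ->
  ~ mu.-negligible (`]x, y]%classic : set (measurableTypeR R)).
Proof.
move=> cx xy yc sxy; have [muE _] := mur.
move=> /measure_negligible muxy.
have : mu `]x, y]%classic = 0%E by apply: muxy; exact: measurable_itv.
rewrite muE ?(ltW xy)// => -[] /eqP.
by rewrite subr_eq0 gt_eqF.
Qed.

End BendMeasure.

Section IntegralOfSignedFunction.
Context d (T : measurableType d) (R : realType) (mu : {measure set T -> \bar R}).

Lemma integral_ae_zero (A : set T) (D : T -> R) : measurable A ->
  measurable_fun A D -> mu.-negligible (A `&` [set x | D x <> 0]) ->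
  (\int[mu]_(x in A) (D x)%:E = 0)%E.
Proof.
move=> mA mD neg.
rewrite (@ae_eq_integral _ _ _ mu A (cst 0%E) (EFin \o D))//.
- by rewrite integral0.
- exact/measurable_EFinP.
- apply: negligibleS neg => x /= /not_implyP[Ax Dx]; split => // D0.
  by apply: Dx; rewrite D0.
Qed.

Lemma ae_zero_of_integral (A : set T) (D : T -> R) : measurable A ->
  measurable_fun A D -> (forall x, A x -> D x <= 0) ->
  (- (\int[mu]_(x in A) (D x)%:E) = 0)%E ->
  mu.-negligible (A `&` [set x | D x <> 0]).
Proof.
move=> mA mD D0 iD.
have : ae_eq mu A (EFin \o D) (cst 0%E).
  apply/ae_eq_integral_abs => //; first exact/measurable_EFinP.
  have -> : (\int[mu]_(x in A) `|(EFin \o D) x| = \int[mu]_(x in A) (- D x)%:E)%E.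
    apply: eq_integral => x; rewrite inE => Ax.
    by rewrite /= ler0_norm// D0.
  rewrite -iD -[LHS]oppeK; congr (- _)%E; rewrite -integral_ge0N; last first.
    by move=> x Ax; rewrite lee_fin oppr_ge0 D0.
  by apply: eq_integral => x _; rewrite /= opprK.
apply: negligibleS => x /= [Ax Dx]; apply/not_implyP; split => //.
by move=> [].
Qed.

End IntegralOfSignedFunction.

(** * The pathwise characterization *)

Section PathwiseCharacterization.
Context {R : realType}.
Implicit Types (X rhat HR HL : R -> R) (c k tau x lam : R).

Lemma is_derive_YR X tau x : continuous X ->
  is_derive x 1 (YR X tau) (X x - X tau).
Proof.
move=> cX; apply: (@is_derive_oriented_integral _ (XR X tau)).
by move=> y; apply: cvgB; [exact: cX|exact: cvg_cst].
Qed.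

Lemma is_derive_YL X tau x : continuous X ->
  is_derive x 1 (YL X tau) (X x - X tau).
Proof.
move=> cX; have -> : YL X tau = - oriented_integral (XL X tau) tau.
  by apply/funext => t; rewrite /YL oriented_integralN.
rewrite -[X x - X tau]opprB; apply: is_deriveN.
apply: (@is_derive_oriented_integral _ (XL X tau)).
by move=> y; apply: cvgB; [exact: cvg_cst|exact: cX].
Qed.

Lemma clamp_continuous c rhat : 0 < c -> {within `[- c, c], continuous rhat} ->
  continuous (fun x => rhat (Num.max (- c) (Num.min x c))).
Proof.
move=> c0 crhat x.
have cl y : - c <= Num.max (- c) (Num.min y c) <= c.
  by rewrite le_max lexx/= ge_max ge_min lexx orbT andbT; lra.
have ccl : {for x, continuous (fun y : R => Num.max (- c) (Num.min y c))}.
  apply: continuous_max; first exact: cvg_cst.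
  by apply: continuous_min; [exact: cvg_id|exact: cvg_cst].
move/subspace_continuousP : crhat => /(_ (Num.max (- c) (Num.min x c))).
rewrite /= in_itv/= => /(_ (cl x)) crhat.
apply: (cvg_comp (fun y => Num.max (- c) (Num.min y c)) rhat _ crhat).
move=> A /ccl; apply: (@filterS _ (nbhs x)) => y; apply.
by rewrite /= in_itv; exact: cl.
Qed.

Lemma integral_minus_dderiv_eq0 c rhat (mu : {measure set (measurableTypeR R) -> \bar R})
    (Q D : R -> R) a b :
  concave_on `[- c, c] rhat -> is_minus_dderiv c rhat mu ->
  - c <= a -> b <= c -> continuous Q -> (forall x, a <= x <= b -> D x = Q x) ->
  (forall x, is_bend (- c) c rhat x -> - c < x < c -> Q x = 0) ->
  (\int[mu]_(x in `[a, b]) (D x)%:E = 0)%E.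
Proof.
move=> rconc mur ca bc cQ DQ Q0; apply: integral_ae_zero => //.
  apply: (eq_measurable_fun Q); first by move=> x; rewrite inE/= in_itv/= => /DQ.
  by apply: measurable_funTS; exact: continuous_measurable_fun.
apply: (negligible_no_bend rconc mur) => z [] /=; rewrite in_itv/= => zI Dz zc bz.
by apply: Dz; rewrite DQ// Q0.
Qed.

(** Both one-sided functions are written as B minus a multiple of the tent; the
    theorem then compares the two multiples with the multiplier of the
    optimality criterion. *)
Lemma argmin_characterization X c k rhat
    (mu : {measure set (measurableTypeR R) -> \bar R}) HR HL :
  continuous X -> 0 < c ->
  let tR := tauR c rhat in
  let tL := tauL c rhat in
  let DR := fun t => HR t - YR X tR t in
  let DL := fun t => HL t - YL X tL t in
  concave_class c k rhat ->
  {within `[- c, c], continuous rhat} ->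
  knots rhat `&` `[0, c[ !=set0 ->
  knots rhat `&` `]- c, 0] !=set0 ->
  is_minus_dderiv c rhat mu ->
  is_second_antiderivative rhat HR (- c) c ->
  HR c = YR X tR c ->
  HR tR = YR X tR tR ->
  is_second_antiderivative rhat HL (- c) c ->
  HL (- c) = YL X tL (- c) ->
  HL tL = YL X tL tL ->
  (is_argmin `[- c, c] (concave_class c k) (phi X c) rhat <->
   [/\ DR 0 = DL 0,
       (forall t, 0 <= t <= c -> DR t <= 0) /\
       (forall t, - c <= t <= 0 -> DL t <= 0) &
       (- (\int[mu]_(t in `[(- c)%R, 0%R]) (DL t)%:E) = 0)%E /\
       (- (\int[mu]_(t in `[0%R, c]) (DR t)%:E) = 0)%E]).
Proof.
move=> cX c0 tR tL DR DL C0 crhat knR knL mur HR2 HRc HRt HL2 HLc HLt.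
have [rconc _ _ _] := C0.
pose rc x := rhat (Num.max (- c) (Num.min x c)).
have crc : continuous rc by exact: clamp_continuous.
have rcE : {in `[- c, c], rc =1 rhat}.
  by move=> x; rewrite in_itv/= => /andP[cx xc]; rewrite /rc min_l// max_r.
pose G := oriented_integral rc 0.
have dG x : is_derive x 1 G (rc x) by exact: is_derive_oriented_integral.
have cE : continuous (G \- X).
  by move=> x; apply: cvgB; [exact: (is_derive_continuous dG)|exact: cX].
pose B1 := oriented_integral (G \- X) 0.
have dB1 x : is_derive x 1 B1 (G x - X x) by exact: is_derive_oriented_integral.
(* gam and del are the coefficients of the line through the endpoint values
   of B1, so that B vanishes at - c and c. *)
pose gam := (B1 c - B1 (- c)) / (2 * c).
pose del := (B1 c + B1 (- c)) / 2.
pose B x := B1 x - (gam * x + del).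
have dB x : is_derive x 1 B (G x - X x - gam).
  apply: is_deriveB.
  have d1 := @is_deriveZ _ _ _ id gam x 1 1 (is_derive_id _ _).
  have d2 := @is_deriveD _ _ _ _ (cst del) x 1 _ 0 d1 (is_derive_cst _ _ _).
  by apply: is_derive_eq d2 _; rewrite addr0 [_ *: _]mulr1.
have BNc : B (- c) = 0 by rewrite /B /gam /del; field; rewrite gt_eqF.
have Bc : B c = 0 by rewrite /B /gam /del; field; rewrite gt_eqF.
have cB := is_derive_continuous dB.
pose tent x : R := 1 - `|x| / c.
have tR_in : 0 <= tR < c by exact: tauR_in.
have tL_in : - c < tL <= 0 by exact: tauL_in.
have bR := tauR_is_bend c0 rconc knR.
have bL := tauL_is_bend c0 rconc knL.
have [lamR DRE] : exists lam, forall x, 0 <= x <= c -> DR x = B x - lam * tent x.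
  have [al [be E]] := second_antiderivative_affine c0 rcE dG dB
    (fun x => is_derive_YR tR x cX) HR2.
  have := E c ltac:(lra); rewrite HRc subrr Bc add0r => abc.
  exists (be * c) => x /andP[x0 xc].
  rewrite /DR E ?xc ?andbT; last by lra.
  rewrite /tent ger0_norm//.
  have -> : al = - (be * c) by lra.
  by field; rewrite gt_eqF.
have [lamL DLE] : exists lam, forall x, - c <= x <= 0 -> DL x = B x - lam * tent x.
  have [al [be E]] := second_antiderivative_affine c0 rcE dG dB
    (fun x => is_derive_YL tL x cX) HL2.
  have := E (- c) ltac:(lra); rewrite HLc subrr BNc add0r => abc.
  exists (- be * c) => x /andP[cx x0].
  rewrite /DL E ?cx//=; last by lra.
  rewrite /tent ler0_norm//.
  have -> : al = be * c by lra.
  by field; rewrite gt_eqF.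
have tent0 : tent 0 = 1 by rewrite /tent normr0 mul0r subr0.
have ctent : continuous tent by exact: tent_continuous.
have cQ lam : continuous (fun x => B x - lam * tent x).
  by move=> x; apply: cvgB; [exact: cB|apply: cvgMr; exact: ctent].
split.
- move=> rmin.
  have tRI : - c < tR < c by lra.
  have tLI : - c < tL < c by lra.
  have ble t z : - c < t < c -> - c < z < c -> is_bend (- c) c rhat z ->
      B t * tent z <= B z * tent t.
    by move=> tI zI bz; exact: (argmin_bend_le c0 cX C0 crc rcE dG dB BNc Bc rmin tI zI bz).
  have TR := tent_gt0 c0 tRI; have TL := tent_gt0 c0 tLI.
  have BR : B tR = lamR * tent tR.
    have := DRE tR; rewrite /DR HRt subrr => /(_ _)/eqP.
    by rewrite eq_sym subr_eq0 => H; apply/eqP/H; lra.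
  have BL : B tL = lamL * tent tL.
    have := DLE tL; rewrite /DL HLt subrr => /(_ _)/eqP.
    by rewrite eq_sym subr_eq0 => H; apply/eqP/H; lra.
  have lamE : lamL = lamR.
    have := ble tR tL tRI tLI bL; have := ble tL tR tLI tRI bR.
    rewrite BR BL ![_ * tent tL * tent tR]mulrAC.
    rewrite !ler_pM2r// => h1 h2.
    by apply/eqP; rewrite eq_le h1.
  rewrite lamE in DLE.
  have Qle x : - c <= x <= c -> B x - lamR * tent x <= 0.
    move=> /andP[cx xc].
    have [->|xNc] := eqVneq x (- c).
      by rewrite BNc /tent (tent_Nc c0) mulr0 subrr.
    have [->|xc'] := eqVneq x c.
      by rewrite Bc /tent (tent_c c0) mulr0 subrr.
    have xI : - c < x < c by rewrite !lt_neqAle eq_sym xNc cx xc' xc.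
    have := ble x tR xI tRI bR.
    by rewrite BR mulrAC ler_pM2r// subr_le0.
  have Q0 z : is_bend (- c) c rhat z -> - c < z < c -> B z - lamR * tent z = 0.
    move=> bz zI; apply/eqP; rewrite eq_le Qle ?andTb; last by lra.
    have := ble tR z tRI zI bz.
    by rewrite BR mulrAC ler_pM2r// subr_ge0.
  split.
  + by rewrite DRE ?DLE//; lra.
  + split => t tI; first by rewrite DRE// Qle//; lra.
    by rewrite DLE// Qle//; lra.
  + split; apply/eqP; rewrite oppe_eq0; apply/eqP.
      by apply: (integral_minus_dderiv_eq0 rconc mur _ _ (cQ lamR) DLE Q0); lra.
    by apply: (integral_minus_dderiv_eq0 rconc mur _ _ (cQ lamR) DRE Q0); lra.
- move=> [D0 [DR0 DL0] [iL iR]].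
  have lamE : lamL = lamR.
    by move: D0; rewrite DRE ?DLE ?tent0; lra.
  rewrite lamE in DLE.
  have mD D a b : (forall x, a <= x <= b -> D x = B x - lamR * tent x) ->
      measurable_fun (`[a, b]%classic : set (measurableTypeR R)) D.
    move=> DE; apply: (eq_measurable_fun (fun x => B x - lamR * tent x)).
      by move=> x; rewrite inE/= in_itv/= => /DE.
    by apply: measurable_funTS; exact: continuous_measurable_fun.
  have nL : mu.-negligible (`[- c, 0]%classic `&` [set x | DL x <> 0]).
    by apply: ae_zero_of_integral iL => //; exact: mD.
  have nR : mu.-negligible (`[0, c]%classic `&` [set x | DR x <> 0]).
    by apply: ae_zero_of_integral iR => //; exact: mD.
  apply: (argmin_of_multiplier c0 cX C0 crc rcE dG dB BNc Bc (lam := lamR)).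
    move=> x /andP[cx xc]; rewrite -subr_le0.
    have [x0|/ltW x0] := leP 0 x; first by rewrite -DRE ?DR0 ?x0.
    by rewrite -DLE ?DL0 ?x0 ?andbT.
  move=> x y cx xy yc sxy; apply: contrapT => nz.
  apply: (bend_interval_not_negligible mur cx xy yc sxy).
  apply: (negligibleS _ (negligibleU nL nR)) => z /=; rewrite in_itv/= => /andP[xz zy].
  have zQ : B z - lamR * tent z <> 0.
    by move=> /subr0_eq zE; apply: nz; exists z; rewrite ?(ltW xz).
  have [z0|/ltW z0] := leP 0 z.
    have zI : 0 <= z <= c by rewrite z0 (le_trans zy)// ltW.
    by right; split; rewrite /= ?in_itv//= DRE.
  have zI : - c <= z <= 0 by rewrite z0 andbT ltW// (lt_trans cx).
  by left; split; rewrite /= ?in_itv//= DLE.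
Qed.

End PathwiseCharacterization.

Theorem theorem2 (R : realType) (d : measure_display) (T : measurableType d)
    (P : probability T R) (W : R -> {RV P >-> R})
    (W_brownian : two_sided_brownian W) (k : R) (k_lt0 : k < 0) :
  {ae (@lebesgue_measure R), forall c : R, 0 < c ->
    {ae P, forall w : T,
      forall (rhat : R -> R) (mu : {measure set (measurableTypeR R) -> \bar R})
        (HR HL : R -> R),
      let X := drift_path W w in
      let tR := tauR c rhat in
      let tL := tauL c rhat in
      let DR := fun t => HR t - YR X tR t in
      let DL := fun t => HL t - YL X tL t in
      concave_class c k rhat ->
      {within `[- c, c], continuous rhat} ->
      knots rhat `&` `[0, c[ !=set0 ->
      knots rhat `&` `]- c, 0] !=set0 ->
      is_minus_dderiv c rhat mu ->
      is_second_antiderivative rhat HR (- c) c ->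
      HR c = YR X tR c ->
      HR tR = YR X tR tR ->
      is_second_antiderivative rhat HL (- c) c ->
      HL (- c) = YL X tL (- c) ->
      HL tL = YL X tL tL ->
      (is_argmin `[- c, c] (concave_class c k) (phi X c) rhat <->
       [/\ DR 0 = DL 0,
           (forall t, 0 <= t <= c -> DR t <= 0) /\
           (forall t, - c <= t <= 0 -> DL t <= 0) &
           (- (\int[mu]_(t in `[(- c)%R, 0%R]) (DL t)%:E) = 0)%E /\
           (- (\int[mu]_(t in `[0%R, c]) (DR t)%:E) = 0)%E])}}.
Proof.
apply: nearW => c c0; have [_ Wpaths _ _] := W_brownian.
apply: filterS Wpaths => w cW rhat mu HR HL.
apply: argmin_characterization => // t.
apply: cvgB; first exact: cW.
by apply: cvgMr; exact: exprn_continuous.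
Qed.
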